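(* Let $K\ge2$, $d\ge1$, $n\ge1$ be integers, let $p_d=\frac{2d}{d+1}$, and put $\psi(K)=K\prod_{p\mid K}(1+1/p)$ (product over the primes $p$ dividing $K$). For every normalized local basis $\mathcal B$ of $M_K(\mathbb C)$ and every $A\in\mathcal H_{\le d,K}(n)$, $$\|\widehat A_{\mathcal B}\|_{\ell_{p_d}}\le\sqrt{K^2-1}\;\psi(K)^d\;\mathrm{BH}^{\mathrm{supp}}_{d,K}\;\|A\|_{\mathrm{op}}.$$ Consequently $\beta(K)\le\psi(K)$ for every $K\ge2$.
   Context: $M_K(\mathbb C)$ is the algebra of complex $K\times K$ matrices and $M_K^0=\{A\in M_K(\mathbb C):\operatorname{tr}A=0\}$. A normalized local basis is a family $\mathcal B=\{B_0=I,B_1,\ldots,B_{K^2-1}\}$ that is an orthonormal basis of $M_K(\mathbb C)$ for $\langle A,B\rangle=\frac1K\operatorname{tr}(AB^* )$ (so $B_\mu\in M_K^0$ for $\mu\ge1$). For $\beta\in\{0,\ldots,K^2-1\}^n$ put $B_\beta=B_{\beta_1}\otimes\cdots\otimes B_{\beta_n}$, and for $A\in M_K(\mathbb C)^{\otimes n}\cong M_{K^n}(\mathbb C)$ let $\widehat A_{\mathcal B}(\beta)=K^{-n}\operatorname{tr}(AB_\beta^* )$; $\|\widehat A_{\mathcal B}\|_{\ell_p}=(\sum_\beta|\widehat A_{\mathcal B}(\beta)|^p)^{1/p}$, and $\|\cdot\|_{\mathrm{op}}$ is the operator norm. For $S\subset[n]$ let $\mathcal H_S=(\bigotimes_{j\in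 S}M_K^0)\otimes(\bigotimes_{j\notin S}\mathbb CI)$, $\mathcal H_{d,K}(n)=\bigoplus_{|S|=d}\mathcal H_S$, $\mathcal H_{\le d,K}(n)=\bigoplus_{|S|\le d}\mathcal H_S$. $C_{d,K}$ is the least constant, uniform in $n$ and $\mathcal B$, with $\|\widehat A_{\mathcal B}\|_{\ell_{p_d}}\le C_{d,K}\|A\|_{\mathrm{op}}$ for all $A\in\mathcal H_{d,K}(n)$, and $\beta(K)=\limsup_{d\to\infty}C_{d,K}^{1/d}$. Commutative constant: let $C_K\subset\mathbb C$ be the group of $K$-th roots of unity and $\chi_m(x)=x_1^{m_1}\cdots x_N^{m_N}$ for $m\in\mathbb Z_K^N$, $x\in C_K^N$. $\mathrm{BH}^{\mathrm{supp}}_{d,K}$ is the least constant, uniform in $N$, such that $(\sum_m|\widehat f(m)|^{p_d})^{1/p_d}\le\mathrm{BH}^{\mathrm{supp}}_{d,K}\max_{x\in C_K^N}|f(x)|$ for every $f=\sum_m\widehat f(m)\chi_m$ on $C_K^N$ with $\widehat f(m)=0$ unless $|\{j:m_j\ne0\}|\le d$. It is a known result (Pellegrino--Raposo) that for fixed $K$ these constants are finite and grow subexponentially: $\limsup_{d\to\infty}(\mathrm{BH}^{\mathrm{supp}}_{d,K})^{1/d}\le1$. *)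

(* Defs.v *)
(* MathComp + MathComp-Analysis; the complex numbers are R[i] for R : realType. *)
From HB Require Import structures.
From mathcomp Require Export all_boot all_order all_algebra.
From mathcomp Require Export all_classical all_reals all_analysis.
From mathcomp Require Export complex.

Set Implicit Arguments.
Unset Strict Implicit.
Unset Printing Implicit Defensive.

Import Order.TTheory GRing.Theory Num.Theory.
Import ComplexField.Normc.

Local Open Scope classical_set_scope.
Local Open Scope sesquilinear_scope.
Local Open Scope complex_scope.
Local Open Scope ring_scope.

(* p_d = 2d / (d + 1) *)
Definition bh_exp (R : realType) (d : nat) : R := (2 * d)%:R / d.+1%:R.

(* psi(K) = K * prod_{p | K, p prime} (1 + 1/p) *)
Definition dedekind_psi (R : realType) (K : nat) : R :=
  K%:R * \prod_(p <- primes K) (1 + p%:R^-1).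

Definition lp_norm (R : realType) (I : finType) (p : R) (a : I -> R[i]) : R :=
  (\sum_(i : I) normc (a i) `^ p) `^ p^-1.

Definition vec_norm (R : realType) (m : nat) (v : 'cV[R[i]]_m) : R :=
  Num.sqrt (\sum_(i < m) normc (v i 0) ^+ 2).

Definition op_norm (R : realType) (m : nat) (A : 'M[R[i]]_m) : R :=
  sup [set vec_norm (A *m v) | v in [set v : 'cV[R[i]]_m | vec_norm v <= 1]].

(* <A, B> = tr(A B^* ) / m; for m = K this is the inner product of M_K(C), and
   for m = K^n it gives the coefficients of A in a tensor basis. *)
Definition ntr_dot (R : realType) (m : nat) (A B : 'M[R[i]]_m) : R[i] :=
  m%:R^-1 * \tr (A *m B ^t*).

Definition normalized_local_basis (R : realType) (K : nat)
    (B : 'I_(K ^ 2) -> 'M[R[i]]_K) : Prop :=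
  [/\ forall i : 'I_(K ^ 2), i = 0 :> nat -> B i = 1%:M,
      forall i j : 'I_(K ^ 2), ntr_dot (B i) (B j) = (i == j)%:R
    & basis_of fullv (codom B)].

(* M_K(C)^{(x) n}, identified with M_{K^n}(C): the standard basis vectors of
   (C^K)^{(x) n} are labelled by the words 'I_n -> 'I_K, enumerated by enum. *)
Definition tensor_dim (K n : nat) : nat := #|{ffun 'I_n -> 'I_K}|.

Lemma tensor_dimE (K n : nat) : tensor_dim K n = (K ^ n)%N.
Proof. by rewrite /tensor_dim card_ffun !card_ord. Qed.

Definition word (K n : nat) (i : 'I_(tensor_dim K n)) : {ffun 'I_n -> 'I_K} :=
  enum_val i.

Definition tensor (R : realType) (K n : nat) (T : 'I_n -> 'M[R[i]]_K) :
    'M[R[i]]_(tensor_dim K n) :=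
  \matrix_(i, j) \prod_(k < n) T k (word i k) (word j k).

Definition local_coef (R : realType) (K n : nat) (B : 'I_(K ^ 2) -> 'M[R[i]]_K)
    (A : 'M[R[i]]_(tensor_dim K n)) (b : {ffun 'I_n -> 'I_(K ^ 2)}) : R[i] :=
  ntr_dot A (tensor (fun j => B (b j))).

(* H_S: the linear span of the pure tensors whose factors are traceless at the
   sites in S and scalar at the other sites. *)
Definition site_space (R : realType) (K n : nat) (S : {set 'I_n}) :
    set 'M[R[i]]_(tensor_dim K n) :=
  [set A | exists (m : nat) (c : 'I_m -> R[i])
             (T : 'I_m -> 'I_n -> 'M[R[i]]_K),
     (forall l j, if j \in S then \tr (T l j) = 0 else is_scalar_mx (T l j)) /\
     A = \sum_(l < m) c l *: tensor (T l)].

Definition sum_site_spaces (R : realType) (K n : nat) (P : pred {set 'I_n}) :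
    set 'M[R[i]]_(tensor_dim K n) :=
  [set A | exists AS : {set 'I_n} -> 'M[R[i]]_(tensor_dim K n),
     (forall S, P S -> site_space (K := K) S (AS S)) /\
     A = \sum_(S | P S) AS S].

Definition Hdeg (R : realType) (d K n : nat) :
    set 'M[R[i]]_(tensor_dim K n) :=
  sum_site_spaces (fun S : {set 'I_n} => #|S| == d).

Definition Hledeg (R : realType) (d K n : nat) :
    set 'M[R[i]]_(tensor_dim K n) :=
  sum_site_spaces (fun S : {set 'I_n} => (#|S| <= d)%N).

(* C_{d,K}; +oo if no finite constant works. *)
Definition bh_const (R : realType) (d K : nat) : \bar R :=
  ereal_inf [set c%:E | c in [set c : R |
    forall (n : nat) (B : 'I_(K ^ 2) -> 'M[R[i]]_K)
           (A : 'M[R[i]]_(tensor_dim K n)),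
      (1 <= n)%N -> normalized_local_basis B -> Hdeg d A ->
      lp_norm (bh_exp R d) (local_coef B A) <= c * op_norm A]].

(* beta(K) *)
Definition bh_growth (R : realType) (K : nat) : \bar R :=
  limn_esup (fun d : nat => poweR (bh_const R d K) d%:R^-1).

(* An index m in Z_K^N is given by its representatives in {0, ..., K-1}. *)
Definition cyc_char (R : realType) (K N : nat) (m : {ffun 'I_N -> 'I_K})
    (x : 'I_N -> R[i]) : R[i] :=
  \prod_(j < N) x j ^+ m j.

Definition cyc_poly (R : realType) (K N : nat)
    (a : {ffun 'I_N -> 'I_K} -> R[i]) (x : 'I_N -> R[i]) : R[i] :=
  \sum_(m : {ffun 'I_N -> 'I_K}) a m * cyc_char m x.

Definition cyc_group (R : realType) (K N : nat) : set ('I_N -> R[i]) :=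
  [set x | forall j, x j ^+ K = 1].

(* The maximum of |f| over C_K^N, a finite nonempty set. *)
Definition cyc_max (R : realType) (K N : nat) (f : ('I_N -> R[i]) -> R[i]) : R :=
  sup [set normc (f x) | x in @cyc_group R K N].

(* BH^supp_{d,K}; +oo if no finite constant works. *)
Definition bh_supp (R : realType) (d K : nat) : \bar R :=
  ereal_inf [set c%:E | c in [set c : R |
    forall (N : nat) (a : {ffun 'I_N -> 'I_K} -> R[i]),
      (1 <= N)%N ->
      (forall m : {ffun 'I_N -> 'I_K},
         (d < #|[set j | m j != 0 :> nat]|)%N -> a m = 0) ->
      lp_norm (bh_exp R d) a <= c * cyc_max K (cyc_poly a)]].

(* Main.v *)
(** Write w(a, b) = X^a Z^b for the Weyl matrices of M_K(C).  A cyclic subgroup of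
order K of (Z/K)^2 gives, after a choice of phase, a unitary U with U^K = 1 whose
powers are Weyl matrices up to phase.  Choosing such a U_j at every site, the
coefficients of A on the tensors of powers U_j^(m_j) are those of a polynomial f
on C_K^n, and f(x) is the normalized trace of A against a positive matrix of
normalized trace 1, namely a multiple of a joint spectral projection; hence
|f| <= ||A||_op, and the commutative inequality bounds these coefficients.

The group (Z/K)^2 is covered by psi(K) such subgroups (the points of the
projective line over Z/K).  When the subgroups range over all psi(K)^n choices, a
Weyl tensor of support at most d is met at least psi(K)^(n-d) times, so averaging
costs a factor psi(K)^d.  Finally the passage from the Weyl basis to an arbitrary
normalized basis is unitary on the span of the basis tensors of a given support S,
of dimension (K^2-1)^|S|, and comparing l_p with l_2 there costs at most
(K^2-1)^(d(1/p-1/2)) = (K^2-1)^(1/2). *)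
Require Import Defs.
From mathcomp Require Import all_boot all_order all_algebra.
From mathcomp Require Import all_classical all_reals all_analysis.
From mathcomp Require Import complex.
From mathcomp Require Import cyclic separable cyclotomic.
From mathcomp Require Import ring lra.

Set Implicit Arguments.
Unset Strict Implicit.
Unset Printing Implicit Defensive.

Import Order.TTheory GRing.Theory Num.Theory.
Import ComplexField.Normc.

Local Open Scope classical_set_scope.
Local Open Scope sesquilinear_scope.
Local Open Scope complex_scope.
Local Open Scope ring_scope.

(** * Inequalities for finite sums *)

(** After division by the total, every term lies in [0, 1], where x <= x^q because q <= 1. With q =
    p/2 and squared moduli this is the comparison of l_2 with l_p. *)
Lemma sum_powR_ge (R : realType) (I : finType) (P : pred I) (t : I -> R) (q : R) :
  0 < q <= 1 -> (forall i, 0 <= t i) ->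
  (\sum_(i | P i) t i) `^ q <= \sum_(i | P i) t i `^ q.
Proof.
move=> /andP[q0 q1] t0; set T := \sum_(i | P i) t i.
have T0 : 0 <= T by exact: sumr_ge0.
have [T00|Tn0] := eqVneq T 0.
  by rewrite T00 powR0 ?gt_eqF// sumr_ge0// => i _; exact: powR_ge0.
have {}T0 : 0 < T by rewrite lt_neqAle eq_sym Tn0.
have -> : T `^ q = \sum_(i | P i) (t i / T) * T `^ q.
  by rewrite -mulr_suml -mulr_suml divff// mul1r.
apply: ler_sum => i Pi.
have -> : t i `^ q = (t i / T) `^ q * T `^ q.
  by rewrite -powRM ?divr_ge0 ?(ltW T0)// divfK.
rewrite ler_wpM2r ?powR_ge0//.
have [->|ti0] := eqVneq (t i) 0; first by rewrite mul0r powR_ge0.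
apply: ger1_powR q1; rewrite divr_gt0//=; last by rewrite lt_neqAle eq_sym ti0/=.
rewrite ler_pdivrMr// mul1r /T (bigD1 i)//= lerDl sumr_ge0//.
Qed.

(** Weighted arithmetic-geometric mean inequality: Young's inequality for the conjugate exponents
    1/q and 1/(1-q). *)
Lemma young_powR (R : realType) (q t m : R) : 0 < q < 1 -> 0 <= t -> 0 <= m ->
  t `^ q * m `^ (1 - q) <= q * t + (1 - q) * m.
Proof.
move=> /andP[q0 q1] t0 m0; have q1' : 0 < 1 - q by rewrite subr_gt0.
have := @conjugate_powR R (t `^ q) (m `^ (1 - q)) q^-1 (1 - q)^-1
  (powR_ge0 _ _) (powR_ge0 _ _).
rewrite !invr_gt0 !invrK -!powRrM !mulfV ?gt_eqF// !powRr1// subrKC.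
by rewrite (mulrC t) (mulrC m); apply.
Qed.

(** Concavity of x^q, the reverse comparison; the price is a power of the number of terms. *)
Lemma sum_powR_le (R : realType) (I : finType) (P : pred I) (t : I -> R) (q : R) :
  0 < q < 1 -> (forall i, 0 <= t i) ->
  \sum_(i | P i) t i `^ q <= #|P|%:R `^ (1 - q) * (\sum_(i | P i) t i) `^ q.
Proof.
move=> /andP[q0 q1] t0; set T := \sum_(i | P i) t i.
have T0 : 0 <= T by exact: sumr_ge0.
have [T00|Tn0] := eqVneq T 0.
  rewrite big1 ?mulr_ge0 ?powR_ge0// => i Pi.
  have /eqP := T00; rewrite psumr_eq0// => /allP/(_ i (mem_index_enum _)).
  by rewrite Pi => /eqP ->; rewrite powR0 ?gt_eqF.
have {}T0 : 0 < T by rewrite lt_neqAle eq_sym Tn0.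
have N0 : 0 < (#|P|%:R : R).
  rewrite ltr0n lt0n; apply: contraNneq Tn0 => /card0_eq P0.
  by rewrite /T big_pred0.
set N := #|P|%:R in N0 *; set m := T / N.
have m0 : 0 < m by rewrite divr_gt0.
have q1' : 0 < 1 - q by rewrite subr_gt0.
(* Each term is paired with the mean [m]; the right-hand sides then add up to q T + (1 - q) T =
   T. *)
have H : (\sum_(i | P i) t i `^ q) * m `^ (1 - q) <= T.
  rewrite mulr_suml (@le_trans _ _ (\sum_(i | P i) (q * t i + (1 - q) * m)))//.
    by apply: ler_sum => i _; apply: young_powR => //; [rewrite q0|exact: ltW].
  rewrite big_split/= -mulr_sumr sumr_const -[_ *+ _]mulr_natl -/T -/N.
  have -> : N * ((1 - q) * m) = (1 - q) * T by rewrite /m mulrCA mulrC (mulrC N) divfK ?gt_eqF// mulrC.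
  by rewrite -mulrDl subrKC mul1r.
rewrite -(ler_pM2r (powR_gt0 (1 - q) m0)) (le_trans H)//.
rewrite mulrAC -powRM ?ler0n ?(ltW m0)// /m (mulrC T) mulrA divff ?gt_eqF// mul1r -powRD; last first.
  by rewrite subrK oner_eq0.
by rewrite subrK powRr1 ?(ltW T0).
Qed.

(** Cauchy-Schwarz through Lagrange's identity: the double sum of the squares of a_i b_j - a_j b_i
    equals 2 (A B - S^2). *)
Lemma sum_mul_le_sqrt (R : realType) (I : finType) (a b : I -> R) :
  \sum_i a i * b i <=
  Num.sqrt (\sum_i a i ^+ 2) * Num.sqrt (\sum_i b i ^+ 2).
Proof.
set A := \sum_i a i ^+ 2; set B := \sum_i b i ^+ 2; set S := \sum_i a i * b i.
have A0 : 0 <= A by apply: sumr_ge0 => i _; exact: sqr_ge0.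
have B0 : 0 <= B by apply: sumr_ge0 => i _; exact: sqr_ge0.
rewrite -sqrtrM// (le_trans (ler_norm _))// -sqrtr_sqr ler_wsqrtr//.
have H : 0 <= \sum_i \sum_j (a i * b j - a j * b i) ^+ 2.
  by apply: sumr_ge0 => i _; apply: sumr_ge0 => j _; exact: sqr_ge0.
suff E : \sum_i \sum_j (a i * b j - a j * b i) ^+ 2 = (A * B - S ^+ 2) *+ 2.
  by move: H; rewrite E pmulrn_lge0// subr_ge0.
have E1 : A * B = \sum_i \sum_j a i ^+ 2 * b j ^+ 2.
  by rewrite mulr_suml; apply: eq_bigr => i _; rewrite mulr_sumr.
have E2 : A * B = \sum_i \sum_j a j ^+ 2 * b i ^+ 2 by rewrite E1 exchange_big.
have E3 : S ^+ 2 = \sum_i \sum_j (a i * b i) * (a j * b j).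
  by rewrite expr2 mulr_suml; apply: eq_bigr => i _; rewrite mulr_sumr.
rewrite mulr2n {1}E1 E2 E3 -!sumrN -!big_split/=.
apply: eq_bigr => i _; rewrite -!sumrN -!big_split/=.
apply: eq_bigr => j _; ring.
Qed.

(** * The projective line over Z/K *)

(* s stands for the projective line over Z/K: generators of cyclic subgroups of
   order K that together cover (Z/K)^2. *)
Definition projective_cover (K : nat) (s : seq (nat * nat)) : Prop :=
  (forall g, g \in s -> forall m, K %| m * g.1 -> K %| m * g.2 -> K %| m)%N /\
  (forall a b, exists2 g, g \in s &
     exists t, a = t * g.1 %[mod K] /\ b = t * g.2 %[mod K])%N.

(** Write a = p^v a' with a' prime to p; then t = c u works for any inverse u of a' modulo p^e. The
    divisibility of t by c lets a factor p of c pass to t. *)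
Lemma prime_power_multiple (p e c a : nat) :
  prime p -> (0 < a)%N ->
  exists t, t * a = p ^ logn p a * c %[mod p ^ e] /\ (c %| t)%N.
Proof.
move=> pp a0; have [a' pa' Ea] := pfactor_coprime pp a0.
have a'0 : (0 < a')%N by move: a0; rewrite Ea muln_gt0 => /andP[].
case: (egcdnP (p ^ e) a'0) => u v Euv _.
exists (c * u)%N; split; last exact: dvdn_mulr.
have -> : (c * u * a = p ^ logn p a * c * (u * a'))%N by rewrite {1}Ea; ring.
rewrite Euv.
have /eqP -> : coprime a' (p ^ e) by rewrite coprime_sym coprimeXl.
by rewrite mulnDr muln1 mulnA -modnDml modnMl add0n.
Qed.

(** The points are (1 : b) and (pa : 1), and their number is p^(e+1) + p^e. The coordinate of
    smaller p-adic valuation serves as multiplier, since the other one is a multiple of it. *)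
Lemma projective_cover_prime_power (p e : nat) : prime p ->
  projective_cover (p ^ e.+1)
    ([seq (1, b) | b <- iota 0 (p ^ e.+1)] ++
     [seq (p * a, 1) | a <- iota 0 (p ^ e)])%N.
Proof.
move=> pp; split=> [g|a b].
  rewrite mem_cat => /orP[] /mapP[x _ ->] m /=; first by rewrite muln1.
  by move=> _; rewrite muln1.
have p0 := prime_gt0 pp; have pe0 k : (0 < p ^ k)%N by rewrite expn_gt0 p0.
(* Since [logn p 0] is 0, valuations are meaningful only for positive representatives; adding the
   modulus provides them. *)
wlog [a0 b0] : a b / (0 < a)%N /\ (0 < b)%N.
  move=> W; have [|g gs [t [ta tb]]] := W (a + p ^ e.+1)%N (b + p ^ e.+1)%N.
    by rewrite !addn_gt0 !pe0 !orbT.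
  by exists g => //; exists t; rewrite -ta -tb !modnDr.
have dv x y : (0 < y)%N -> (logn p x <= logn p y)%N -> (p ^ logn p x %| y)%N.
  by move=> y0 xy; rewrite pfactor_dvdn.
have [ab|ba] := leqP (logn p a) (logn p b).
  have [t [ta _]] := prime_power_multiple e.+1 (b %/ p ^ logn p a) pp a0.
  exists (1, t %% p ^ e.+1)%N.
    by rewrite mem_cat map_f// mem_iota add0n ltn_mod pe0.
  by exists a; rewrite muln1 modnMmr mulnC ta mulnC divnK ?dv.
have pa : (p ^ (logn p b).+1 %| a)%N by rewrite pfactor_dvdn.
have [t [tb pt]] := prime_power_multiple e.+1 (a %/ p ^ logn p b) pp b0.
have pc : (p %| a %/ p ^ logn p b)%N.
  by rewrite -(dvdn_pmul2r (pe0 (logn p b))) divnK ?dv ?(ltnW ba)// -expnS.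
have {pc}pt := dvdn_trans pc pt.
(* Here a = t b modulo p^(e+1) with p dividing t, because the valuation of a strictly exceeds that
   of b. *)
exists (p * (t %/ p %% p ^ e), 1)%N.
  by rewrite mem_cat orbC map_f// mem_iota add0n ltn_mod pe0.
exists b; rewrite muln1; split=> //=.
rewrite muln_modr -expnS (mulnC p) divnK// modnMmr mulnC tb mulnC divnK//.
exact/dv/ltnW.
Qed.

(** Chinese remainders, applied separately to the coordinates of the generators and to the
    multipliers. *)
Lemma projective_cover_coprime (m n : nat) (s r : seq (nat * nat)) :
  coprime m n -> projective_cover m s -> projective_cover n r ->
  projective_cover (m * n)
    [seq (chinese m n g.1 h.1, chinese m n g.2 h.2) | g <- s, h <- r].
Proof.
move=> cmn [ps cs] [pr cr]; split=> [g|a b].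
  move=> /allpairsP[[x y] /= [xs yr ->]] k /=.
  have dm u v : (m * n %| k * chinese m n u v)%N -> (m %| k * u)%N && (n %| k * v)%N.
    rewrite Gauss_dvd// => /andP[] /eqP d1 /eqP d2; rewrite /dvdn.
    by rewrite -modnMmr -(chinese_modl cmn u v) modnMmr d1 -(modnMmr k v)
      -(chinese_modr cmn u v) modnMmr d2.
  move=> /dm/andP[x1 y1] /dm/andP[x2 y2]; rewrite Gauss_dvd//.
  by apply/andP; split; [exact: (ps x xs)|exact: (pr y yr)].
have [g gs [t [ga gb]]] := cs a b; have [h hr [u [ha hb]]] := cr a b.
exists (chinese m n g.1 h.1, chinese m n g.2 h.2).
  by apply/allpairsP; exists (g, h).
have E x y z : x = t * y %[mod m] -> x = u * z %[mod n] ->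
    x = chinese m n t u * chinese m n y z %[mod m * n].
  move=> xy xz; apply/eqP; rewrite chinese_remainder//; apply/andP; split; apply/eqP.
    by rewrite xy -[RHS]modnMm !chinese_modl// modnMm.
  by rewrite xz -[RHS]modnMm !chinese_modr// modnMm.
by exists (chinese m n t u); split; apply: E.
Qed.

Lemma dedekind_psi_cover (R : realType) (K : nat) : (0 < K)%N ->
  exists2 s, projective_cover K s & (size s)%:R = dedekind_psi R K.
Proof.
move=> K0; pose F (ps : seq nat) := (\prod_(p <- ps) p ^ logn p K)%N.
have EK : K = F (primes K).
  by rewrite {1}(prod_prime_decomp K0) prime_decompE big_map.
have [s cs ss] : exists2 s, projective_cover (F (primes K)) s &
    (size s)%:R = (F (primes K))%:R * \prod_(p <- primes K) (1 + p%:R^-1) :> R.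
  have : all (fun p => p \in primes K) (primes K) by apply/allP.
  (* The occurrence of [primes K] in the membership predicate stays fixed, so the members of the
     shrinking list are still known to be prime divisors of K. *)
  elim: {1 3 4 5 6}(primes K) (primes_uniq K) => [|p ps IH] /=.
    move=> _ _; exists [:: (1, 1)%N]; last by rewrite /F !big_nil mulr1.
    rewrite /F big_nil; split=> [g _ m|a b]; first by rewrite !dvd1n.
    by exists (1, 1)%N; rewrite ?mem_head//; exists 0%N; rewrite !modn1.
  move=> /andP[pps ups] /andP[pK psK]; have [s cs ss] := IH ups psK.
  have pp : prime p by move: pK; rewrite mem_primes => /andP[].
  have l0 : (0 < logn p K)%N by rewrite logn_gt0.
  have cop : coprime (p ^ logn p K) (F ps).
    rewrite coprimeXl// /F big_seq; apply: (big_ind (fun k => coprime p k)) => [|x y|q qs].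
    - exact: coprimen1.
    - by rewrite coprimeMr => -> ->.
    - have /allP/(_ q qs) := psK; rewrite mem_primes => /andP[qp _].
      rewrite coprimeXr// prime_coprime// dvdn_prime2//.
      by apply: contraNneq pps => ->.
  have cp := projective_cover_prime_power (logn p K).-1 pp.
  rewrite prednK// in cp.
  have := projective_cover_coprime cop cp cs; set r := (X in projective_cover _ X) => cr.
  exists r; first by rewrite /F big_cons.
  rewrite /r size_allpairs size_cat !size_map !size_iota natrM ss /F !big_cons natrM.
  rewrite mulrACA; congr (_ * _); rewrite mulrDr mulr1 natrD; congr (_ + _).
  by rewrite -{2}(prednK l0) expnSr natrM mulfK// pnatr_eq0 -lt0n prime_gt0.
by exists s; rewrite /dedekind_psi {1}EK.
Qed.

(** * Norms and traces of complex matrices *)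

Section ComplexMatrices.
Variable R : realType.
Local Notation C := R[i].
Implicit Types (z : C) (m n : nat).

Lemma normc_ge0 z : 0 <= normc z.
Proof. by case: z => a b; exact: sqrtr_ge0. Qed.

Lemma normc_sqrE z : (normc z ^+ 2)%:C = z * z^*.
Proof. by rewrite rmorphXn/=; exact: normCK. Qed.

Lemma normc_conj z : normc z^* = normc z.
Proof. by apply: (@complexI R); exact: (norm_conjC z). Qed.

Lemma normc_prod (I : finType) (F : I -> C) :
  normc (\prod_i F i) = \prod_i normc (F i).
Proof. by apply: big_morph; [exact: normcM|exact: normc1]. Qed.

Lemma normcX z k : normc (z ^+ k) = normc z ^+ k.
Proof. by elim: k => [|k IH]; rewrite ?expr0 ?normc1// !exprS normcM IH. Qed.

Lemma normc_real (x : R) : 0 <= x -> normc x%:C = x.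
Proof. by move=> x0; rewrite /= expr0n/= addr0 sqrtr_sqr ger0_norm. Qed.

Lemma normc_unit_conj z : normc z = 1 -> z * z^* = 1.
Proof. by move=> z1; rewrite -normc_sqrE z1 expr1n. Qed.

Lemma normc_root_unity z k : (0 < k)%N -> normc (z ^+ k) = 1 -> normc z = 1.
Proof.
move=> k0; rewrite normcX => /eqP; rewrite pexpr_eq1 ?normc_ge0//.
by move=> /eqP.
Qed.

Lemma ler_normc_sum (I : finType) (P : pred I) (F : I -> C) :
  normc (\sum_(i | P i) F i) <= \sum_(i | P i) normc (F i).
Proof.
elim/big_ind2 : _ => // [|x y z t xy zt]; first by rewrite normc0.
by rewrite (le_trans (le_normcD _ _))// lerD.
Qed.

Lemma conj_trmx_mul m n p (A : 'M[C]_(m, n)) (B : 'M[C]_(n, p)) :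
  (A *m B)^t* = B^t* *m A^t*.
Proof. by rewrite trmx_mul map_mxM. Qed.

Lemma conj_trmxK m n (A : 'M[C]_(m, n)) : A^t*^t* = A.
Proof. by apply/matrixP => i j; rewrite !mxE conjCK. Qed.

Lemma vec_norm_ge0 m (v : 'cV[C]_m) : 0 <= vec_norm v.
Proof. exact: sqrtr_ge0. Qed.

Lemma vec_norm_sqr m (v : 'cV[C]_m) :
  vec_norm v ^+ 2 = \sum_(i < m) normc (v i 0) ^+ 2.
Proof. by rewrite sqr_sqrtr// sumr_ge0// => i _; exact: sqr_ge0. Qed.

Lemma vec_normZ m a (v : 'cV[C]_m) : vec_norm (a *: v) = normc a * vec_norm v.
Proof.
apply/eqP; rewrite -(@eqrXn2 _ 2) ?mulr_ge0 ?vec_norm_ge0 ?normc_ge0//.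
rewrite exprMn !vec_norm_sqr mulr_sumr; apply/eqP/eq_bigr => i _.
by rewrite mxE normcM exprMn.
Qed.

Lemma normc_le_vec_norm m (v : 'cV[C]_m) i : normc (v i 0) <= vec_norm v.
Proof.
rewrite -(@ler_pXn2r _ 2) ?nnegrE ?normc_ge0 ?vec_norm_ge0// vec_norm_sqr.
by rewrite (bigD1 i)//= lerDl sumr_ge0// => j _; exact: sqr_ge0.
Qed.

Lemma vec_norm_le m (v w : 'cV[C]_m) :
  (forall i, normc (v i 0) <= normc (w i 0)) -> vec_norm v <= vec_norm w.
Proof.
move=> vw; rewrite ler_wsqrtr// ler_sum// => i _.
by rewrite ler_pXn2r ?nnegrE ?normc_ge0.
Qed.

(** This makes the [sup] in [op_norm] a genuine supremum. On the unit ball all coordinates of v have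
    modulus at most 1, so row sums of moduli bound the image. *)
Lemma op_norm_has_ubound m (A : 'M[C]_m) :
  has_ubound [set vec_norm (A *m v) | v in [set v : 'cV[C]_m | vec_norm v <= 1]].
Proof.
pose w : 'cV[C]_m := \col_i (\sum_j normc (A i j))%:C.
exists (vec_norm w) => _ [v /= v1 <-]; apply: vec_norm_le => i.
rewrite !mxE (le_trans (ler_normc_sum _ _))// normc_real; last first.
  by apply: sumr_ge0 => j _; exact: normc_ge0.
apply: ler_sum => j _; rewrite normcM -[leRHS]mulr1 ler_wpM2l ?normc_ge0//.
exact: le_trans (normc_le_vec_norm _ _) v1.
Qed.

Lemma vec_norm_eq0 m (v : 'cV[C]_m) : vec_norm v = 0 -> v = 0.
Proof.
move=> v0; apply/colP => i; rewrite mxE; apply: eq0_normc; apply/eqP.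
by rewrite eq_le normc_ge0 andbT -v0 normc_le_vec_norm.
Qed.

Lemma vec_norm0 m : vec_norm (0 : 'cV[C]_m) = 0.
Proof. by rewrite -(scale0r 0) vec_normZ normc0 mul0r. Qed.

Lemma op_norm_ub m (A : 'M[C]_m) (v : 'cV[C]_m) :
  vec_norm v <= 1 -> vec_norm (A *m v) <= op_norm A.
Proof. by move=> v1; apply: (ub_le_sup (op_norm_has_ubound A)); exists v. Qed.

Lemma op_norm_ge0 m (A : 'M[C]_m) : 0 <= op_norm A.
Proof.
by rewrite (le_trans (vec_norm_ge0 (A *m 0)))// op_norm_ub// vec_norm0.
Qed.

Lemma vec_norm_mulmx_le m (A : 'M[C]_m) (v : 'cV[C]_m) :
  vec_norm (A *m v) <= op_norm A * vec_norm v.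
Proof.
have [/vec_norm_eq0 ->|v0] := eqVneq (vec_norm v) 0.
  by rewrite mulmx0 vec_norm0 mulr0.
have {}v0 : 0 < vec_norm v by rewrite lt_neqAle eq_sym v0 vec_norm_ge0.
have vi : normc (vec_norm v)^-1%:C = (vec_norm v)^-1.
  by rewrite normc_real// invr_ge0 ltW.
have := @op_norm_ub _ A ((vec_norm v)^-1%:C *: v).
rewrite -scalemxAr !vec_normZ vi mulVf ?gt_eqF// => /(_ (lexx _)).
by rewrite ler_pdivrMl// mulrC.
Qed.

Lemma op_norm_eq0 m (A : 'M[C]_m) : op_norm A = 0 -> A = 0.
Proof.
move=> A0; apply/matrixP => i j.
have /vec_norm_eq0/colP/(_ i) : vec_norm (A *m delta_mx j 0) = 0.
  by apply/eqP; rewrite eq_le vec_norm_ge0 andbT -[leRHS](mul0r (vec_norm (delta_mx j 0))) -A0 vec_norm_mulmx_le.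
by rewrite -colE !mxE.
Qed.

Lemma quadratic_form_le m (A : 'M[C]_m) (v : 'cV[C]_m) :
  normc ((v^t* *m A *m v) 0 0) <= op_norm A * vec_norm v ^+ 2.
Proof.
rewrite -mulmxA mxE (le_trans (ler_normc_sum _ _))//.
have -> : \sum_i normc (v^t* 0 i * (A *m v) i 0) =
          \sum_i normc (v i 0) * normc ((A *m v) i 0).
  by apply: eq_bigr => i _; rewrite normcM !mxE normc_conj.
rewrite (le_trans (sum_mul_le_sqrt _ _))// expr2 mulrCA.
by rewrite ler_wpM2l ?vec_norm_ge0// vec_norm_mulmx_le.
Qed.

(** The trace of A L L^* is the sum of the quadratic forms of A at the columns of L, and the squared
    norms of these columns add up to the trace of L L^*. *)
Lemma trace_positive_le m (A L : 'M[C]_m) (s : R) :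
  \tr (L *m L^t*) = s%:C -> normc (\tr (A *m (L *m L^t*))) <= op_norm A * s.
Proof.
have colq (B : 'M[C]_m) : \tr (B *m L *m L^t*) =
    \sum_i ((col i L)^t* *m B *m col i L) 0 0.
  rewrite mxtrace_mulC; apply: eq_bigr => i _.
  rewrite -(mulmxA _ B) !mxE; apply: eq_bigr => k _; rewrite !mxE.
  by congr (_ * _); apply: eq_bigr => l _; rewrite mxE.
move=> trL; rewrite mulmxA colq (le_trans (ler_normc_sum _ _))//.
(* The column formula is used again, now with the identity in place of A. *)
have -> : s = \sum_i vec_norm (col i L) ^+ 2.
  apply: (@complexI R); rewrite -trL -[L in L *m _]mul1mx colq rmorph_sum/=.
  apply: eq_bigr => i _; rewrite mulmx1 vec_norm_sqr rmorph_sum mxE.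
  by apply: eq_bigr => k _; rewrite [RHS]normc_sqrE !mxE mulrC.
by rewrite mulr_sumr ler_sum// => i _; exact: quadratic_form_le.
Qed.

(** P is c times an orthogonal projection, so P = c^(-1) P P^* is positive, and the factor c cancels
    between P and the trace of P P^*. *)
Lemma ntr_dot_le_op_norm m c (A P : 'M[C]_m) : (0 < m)%N -> (0 < c)%N ->
  P^t* = P -> P *m P = c%:R *: P -> \tr P = m%:R ->
  normc (ntr_dot A P) <= op_norm A.
Proof.
move=> m0 c0 Pa PP trP; rewrite /ntr_dot Pa.
have mR : (m%:R : C) = (m%:R : R)%:C by rewrite rmorph_nat.
have cR : (c%:R : C) = (c%:R : R)%:C by rewrite rmorph_nat.
have EP : P = c%:R^-1 *: (P *m P^t*).
  by rewrite Pa PP scalerA mulVf ?scale1r// pnatr_eq0 -lt0n.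
have trPP : \tr (P *m P^t*) = (c%:R * m%:R : R)%:C.
  by rewrite Pa PP mxtraceZ trP rmorphM/= -mR -cR.
have := trace_positive_le A trPP.
move=> H; rewrite EP -scalemxAr mxtraceZ mulrA normcM.
have -> : normc (m%:R^-1 * c%:R^-1 : C) = (c%:R * m%:R)^-1.
  by rewrite -invfM normcV normcM mR cR !normc_real ?ler0n// mulrC.
by rewrite ler_pdivrMl ?mulr_gt0 ?ltr0n// mulrC.
Qed.

(** * Tensors and orthonormal families *)

Lemma ntr_dotE m (A B : 'M[C]_m) :
  ntr_dot A B = m%:R^-1 * \sum_(p : 'I_m * 'I_m) A p.1 p.2 * (B p.1 p.2)^*.
Proof.
rewrite -(pair_bigA _ (fun i j => A i j * (B i j)^*)) /ntr_dot; congr (_ * _).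
apply: eq_bigr => i _; rewrite mxE.
by apply: eq_bigr => j _; rewrite !mxE.
Qed.

Lemma ntr_dot_conj m (A B : 'M[C]_m) : ntr_dot A B = (ntr_dot B A)^*.
Proof.
rewrite !ntr_dotE rmorphM/= rmorph_sum/= fmorphV rmorph_nat; congr (_ * _).
by apply: eq_bigr => i _; rewrite rmorphM/= conjCK mulrC.
Qed.

Lemma ntr_dotZl m a (A B : 'M[C]_m) : ntr_dot (a *: A) B = a * ntr_dot A B.
Proof. by rewrite /ntr_dot -scalemxAl mxtraceZ mulrCA. Qed.

Lemma ntr_dotZr m a (A B : 'M[C]_m) : ntr_dot A (a *: B) = a^* * ntr_dot A B.
Proof. by rewrite ntr_dot_conj ntr_dotZl rmorphM/= -ntr_dot_conj. Qed.

Lemma ntr_dot_suml m (I : finType) (P : pred I) (A : I -> 'M[C]_m) B :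
  ntr_dot (\sum_(i | P i) A i) B = \sum_(i | P i) ntr_dot (A i) B.
Proof. by rewrite /ntr_dot mulmx_suml raddf_sum mulr_sumr. Qed.

Lemma ntr_dot_sumr m (I : finType) (P : pred I) A (B : I -> 'M[C]_m) :
  ntr_dot A (\sum_(i | P i) B i) = \sum_(i | P i) ntr_dot A (B i).
Proof.
rewrite ntr_dot_conj ntr_dot_suml rmorph_sum.
by apply: eq_bigr => i _; rewrite [RHS]ntr_dot_conj.
Qed.

Lemma ntr_dot0l m (B : 'M[C]_m) : ntr_dot 0 B = 0.
Proof. by rewrite /ntr_dot mul0mx mxtrace0 mulr0. Qed.

Lemma ntr_dot1r m (A : 'M[C]_m) : ntr_dot A 1%:M = m%:R^-1 * \tr A.
Proof. by rewrite /ntr_dot trmx1 map_mx1 mulmx1. Qed.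

(** A one-sided inverse of a square matrix is two-sided; enumerations carry this over to kernels
    indexed by finite types of equal size. *)
Lemma left_inverse_kernel (I J : finType) (u : I -> J -> C) (v : J -> I -> C) :
  #|I| = #|J| ->
  (forall i i', \sum_j u i j * v j i' = (i == i')%:R) ->
  forall j j', \sum_i v j i * u i j' = (j == j')%:R.
Proof.
move=> eIJ uv j j'.
pose M := \matrix_(a < #|I|, b < #|I|) u (enum_val a) (enum_val (cast_ord eIJ b)).
pose N := \matrix_(b < #|I|, a < #|I|) v (enum_val (cast_ord eIJ b)) (enum_val a).
have MN : M *m N = 1%:M.
  apply/matrixP => a a'; rewrite !mxE -(inj_eq enum_val_inj) -uv.
  rewrite [RHS](reindex (fun b : 'I_#|I| => enum_val (cast_ord eIJ b)))/=.
    by apply: eq_bigr => b _; rewrite !mxE.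
  exists (fun j => cast_ord (esym eIJ) (enum_rank j)) => x _.
    by rewrite enum_valK cast_ordK.
  by rewrite cast_ordKV enum_rankK.
have /matrixP/(_ (cast_ord (esym eIJ) (enum_rank j)) (cast_ord (esym eIJ) (enum_rank j'))) := mulmx1C MN.
rewrite !mxE (inj_eq (@cast_ord_inj _ _ _)) (inj_eq enum_rank_inj) => <-.
rewrite (reindex (@enum_val I I))/=.
  by apply: eq_bigr => a _; rewrite !mxE !cast_ordKV !enum_rankK.
by exists enum_rank => x _; rewrite ?enum_valK ?enum_rankK.
Qed.

Definition orthonormal_family K (I : finType) (B : I -> 'M[C]_K) : Prop :=
  forall i j, ntr_dot (B i) (B j) = (i == j)%:R.

(** Orthonormality is a one-sided inverse relation between the matrix of entries of the family and
    its conjugate. As the family has K^2 members, the relation on the other side also holds, and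
    that is completeness, checked here entry by entry. *)
Lemma orthonormal_expansion K (I : finType) (B : I -> 'M[C]_K) :
  (0 < K)%N -> #|I| = (K * K)%N -> orthonormal_family B ->
  forall A, A = \sum_i ntr_dot A (B i) *: B i.
Proof.
move=> K0 cI oB A.
have K1 : (K%:R : C) != 0 by rewrite pnatr_eq0 -lt0n.
have cIJ : #|I| = #|{: 'I_K * 'I_K}| by rewrite card_prod !card_ord.
have H := @left_inverse_kernel I _ (fun i p => K%:R^-1 * B i p.1 p.2)
  (fun p i => (B i p.1 p.2)^*) cIJ.
have {}H : forall p p' : 'I_K * 'I_K,
    \sum_i (B i p.1 p.2)^* * (K%:R^-1 * B i p'.1 p'.2) = (p == p')%:R.
  apply: H => i i'; rewrite -oB ntr_dotE mulr_sumr.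
  by apply: eq_bigr => p _; rewrite mulrA.
apply/matrixP => a b; rewrite summxE.
transitivity (\sum_(p : 'I_K * 'I_K) A p.1 p.2 * (p == (a, b))%:R).
  rewrite (bigD1 (a, b))//= eqxx mulr1 big1 ?addr0// => p /negPf ->.
  by rewrite mulr0.
under eq_bigr => p _ do rewrite -H/= mulr_sumr.
rewrite exchange_big/=; apply: eq_bigr => i _; rewrite mxE ntr_dotE.
rewrite -mulrA mulr_suml mulr_sumr; apply: eq_bigr => p _; ring.
Qed.

Lemma sum_word K n (V : nmodType) (F : {ffun 'I_n -> 'I_K} -> V) :
  \sum_(i < tensor_dim K n) F (word i) = \sum_f F f.
Proof.
rewrite [RHS](reindex (@word K n))//=.
by exists enum_rank => x _; rewrite /word ?enum_valK ?enum_rankK.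
Qed.

Section Tensor.
Variables K n : nat.
Implicit Types S T : 'I_n -> 'M[C]_K.

Lemma eq_tensor S T : S =1 T -> tensor S = tensor T.
Proof. by move=> ST; apply/matrixP => i j; rewrite !mxE; apply: eq_bigr => k _; rewrite ST. Qed.

Lemma tensor_mul S T : tensor S *m tensor T = tensor (fun k => S k *m T k).
Proof.
apply/matrixP => i j; rewrite !mxE.
under [RHS]eq_bigr => k _ do rewrite mxE.
rewrite bigA_distr_bigA -sum_word; apply: eq_bigr => l _.
by rewrite !mxE -big_split.
Qed.

Lemma tensor_conj_trmx T : (tensor T)^t* = tensor (fun k => (T k)^t*).
Proof.
by apply/matrixP => i j; rewrite !mxE rmorph_prod; apply: eq_bigr => k _; rewrite !mxE.
Qed.

Lemma tensor_trace T : \tr (tensor T) = \prod_k \tr (T k).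
Proof.
rewrite bigA_distr_bigA -sum_word; apply: eq_bigr => i _.
by rewrite !mxE.
Qed.

Lemma tensor_sum (I : finType) (F : 'I_n -> I -> 'M[C]_K) :
  tensor (fun k => \sum_i F k i) =
  \sum_(f : {ffun 'I_n -> I}) tensor (fun k => F k (f k)).
Proof.
apply/matrixP => i j; rewrite summxE !mxE.
under eq_bigr => k _ do rewrite summxE.
by rewrite bigA_distr_bigA; apply: eq_bigr => f _; rewrite mxE.
Qed.

Lemma tensor_scale (a : 'I_n -> C) T :
  tensor (fun k => a k *: T k) = (\prod_k a k) *: tensor T.
Proof.
apply/matrixP => i j; rewrite !mxE -big_split.
by apply: eq_bigr => k _; rewrite mxE.
Qed.

Lemma ntr_dot_tensor S T :
  ntr_dot (tensor S) (tensor T) = \prod_k ntr_dot (S k) (T k).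
Proof.
rewrite /ntr_dot tensor_conj_trmx tensor_mul tensor_trace big_split/=.
by rewrite prodr_const card_ord tensor_dimE natrX exprVn.
Qed.

End Tensor.

(** * Parseval's identity on blocks of fixed support *)

(** Expanding the squares brings out the Gram matrix of the columns of V. V appears conjugated
    because coefficients depend antilinearly on the basis. *)
Lemma kernel_isometry (I J : finType) (V : I -> J -> C) (x : J -> C) :
  (forall j j', \sum_i (V i j)^* * V i j' = (j == j')%:R) ->
  \sum_i normc (\sum_j (V i j)^* * x j) ^+ 2 = \sum_j normc (x j) ^+ 2.
Proof.
move=> VV; apply: (@complexI R); rewrite !rmorph_sum.
transitivity (\sum_i \sum_j \sum_j' ((V i j)^* * x j) * ((V i j')^* * x j')^*).
  apply: eq_bigr => i _; rewrite [LHS]normc_sqrE rmorph_sum mulr_suml.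
  by apply: eq_bigr => j _; rewrite mulr_sumr.
rewrite exchange_big/=; apply: eq_bigr => j _; rewrite [RHS]normc_sqrE exchange_big/=.
rewrite (bigD1 j)//= [X in _ + X]big1 ?addr0 => [|j' /negPf jj'].
  transitivity ((\sum_i (V i j)^* * V i j) * (x j * (x j)^*)).
    rewrite mulr_suml; apply: eq_bigr => i _; rewrite rmorphM/= conjCK; ring.
  by rewrite VV eqxx mul1r.
transitivity ((\sum_i (V i j)^* * V i j') * (x j * (x j')^*)).
  rewrite mulr_suml; apply: eq_bigr => i _; rewrite rmorphM/= conjCK; ring.
by rewrite VV eq_sym jj' mul0r.
Qed.

(** A version of [local_coef] over any finite index type, so that it also covers the Weyl matrices,
    which are indexed by pairs. *)
Definition tensor_coef K n (I : finType) (B : I -> 'M[C]_K)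
    (A : 'M[C]_(tensor_dim K n)) (b : {ffun 'I_n -> I}) : C :=
  ntr_dot A (tensor (fun j => B (b j))).

Definition fsupport n (I : finType) (i0 : I) (b : {ffun 'I_n -> I}) : {set 'I_n} :=
  [set j | b j != i0].

(** The transition matrix between the tensor bases is a product over the sites. Since the two
    families share the element at [i0] and [j0], it is block diagonal with respect to supports,
    hence unitary on every block. *)
Lemma block_parseval K n (I J : finType) (B : I -> 'M[C]_K) (W : J -> 'M[C]_K)
    (i0 : I) (j0 : J) (A : 'M[C]_(tensor_dim K n)) (S : {set 'I_n}) :
  (0 < K)%N -> #|I| = (K * K)%N -> #|J| = (K * K)%N ->
  orthonormal_family B -> orthonormal_family W -> B i0 = W j0 ->
  \sum_(b : {ffun 'I_n -> I} | fsupport i0 b == S) normc (tensor_coef B A b) ^+ 2 =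
  \sum_(w : {ffun 'I_n -> J} | fsupport j0 w == S) normc (tensor_coef W A w) ^+ 2.
Proof.
move=> K0 cI cJ oB oW BW0.
pose u i w := ntr_dot (B i) (W w).
have uC w w' : \sum_i (u i w)^* * u i w' = (w == w')%:R.
  rewrite -oW [in RHS](orthonormal_expansion K0 cI oB (W w)) ntr_dot_suml.
  by apply: eq_bigr => i _; rewrite ntr_dotZl /u -ntr_dot_conj.
pose U (b : {ffun 'I_n -> I}) (w : {ffun 'I_n -> J}) := \prod_k u (b k) (w k).
have UC w w' : \sum_b (U b w)^* * U b w' = (w == w')%:R.
  transitivity (\prod_k \sum_i (u i (w k))^* * u i (w' k)).
    rewrite bigA_distr_bigA; apply: eq_bigr => b _.
    by rewrite rmorph_prod -big_split.
  under eq_bigr => k _ do rewrite uC.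
  have [->|/eqP nw] := eqVneq w w'; first by rewrite big1// => k _; rewrite eqxx.
  have [k wk] : exists k, w k != w' k.
    apply/existsP; rewrite -negb_forall; apply/negP => /forallP E; apply: nw.
    by apply/ffunP => k; exact/eqP.
  by rewrite (bigD1 k)//= (negPf wk) mul0r.
(* At a site lying in exactly one of the two supports, the shared element meets another member of
   the same orthonormal family, and that factor vanishes. *)
have U0 b w : fsupport i0 b != fsupport j0 w -> U b w = 0.
  move=> bw; have [k] : exists k, (b k != i0) != (w k != j0).
    apply/existsP; rewrite -negb_forall; apply: contraNN bw => /forallP E.
    by apply/eqP/finset.setP => k; rewrite !inE (eqP (E k)).
  rewrite /U (bigD1 k)//= /u; have [->|bk] := eqVneq (b k) i0.
    by rewrite BW0 oW [j0 == _]eq_sym; case: (w k == j0) => //= _; rewrite mul0r.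
  have [->|//] := eqVneq (w k) j0 => _.
  by rewrite -BW0 oB (negPf bk) mul0r.
have coefE b : tensor_coef B A b = \sum_w (U b w)^* * tensor_coef W A w.
  rewrite /tensor_coef.
  have -> : tensor (fun j => B (b j)) =
      \sum_(w : {ffun 'I_n -> J}) U b w *: tensor (fun j => W (w j)).
    rewrite (eq_tensor (fun j => orthonormal_expansion K0 cJ oW (B (b j)))).
    by rewrite tensor_sum; apply: eq_bigr => w _; rewrite tensor_scale.
  by rewrite ntr_dot_sumr; apply: eq_bigr => w _; rewrite ntr_dotZr.
(* Truncating the coefficients to the block S turns the global isometry into the identity for this
   block. *)
pose x (w : {ffun 'I_n -> J}) : C :=
  if fsupport j0 w == S then tensor_coef W A w else 0.
have := kernel_isometry x UC; rewrite (big_mkcond (fun b => fsupport i0 b == S)).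
rewrite (big_mkcond (fun w => fsupport j0 w == S))/=.
have -> : \sum_w normc (x w) ^+ 2 = \sum_w (if fsupport j0 w == S
    then normc (tensor_coef W A w) ^+ 2 else 0).
  by apply: eq_bigr => w _; rewrite /x; case: ifP => // _; rewrite normc0 expr0n.
move=> <-; apply: eq_bigr => b _; case: ifPn => bS.
  rewrite coefE; congr (normc _ ^+ 2); apply: eq_bigr => w _; rewrite /x.
  case: ifPn => // wS; rewrite U0 ?rmorph0 ?mul0r//.
  by rewrite (eqP bS) eq_sym.
rewrite big1 ?normc0 ?expr0n// => w _; rewrite /x; case: ifPn => wS; last by rewrite mulr0.
by rewrite U0 ?rmorph0 ?mul0r// (eqP wS).
Qed.

(** * Weyl matrices *)

(** X^n - 1 splits and is separable, so it has n distinct roots; n distinct n-th roots of unity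
    include a primitive one. *)
Lemma primitive_root_exists n : (0 < n)%N -> exists z : C, n.-primitive_root z.
Proof.
move=> n0; pose p : {poly C} := 'X^n - 1.
have [r Dp] := closed_field_poly_normal p.
rewrite (monicP _) ?monicXnsubC // scale1r in Dp.
have rn1 : all n.-unity_root r by apply/allP=> z; rewrite -root_prod_XsubC -Dp.
have sz_r : (n < (size r).+1)%N.
  by rewrite -(size_prod_XsubC r id) -Dp size_XnsubC.
have [|z] := hasP (has_prim_root n0 rn1 _ sz_r); last by exists z.
by rewrite -separable_prod_XsubC -Dp separable_Xn_sub_1 // pnatr_eq0 -lt0n.
Qed.

Section Weyl.
Variables (k : nat) (w : C).
Local Notation K := k.+2.
Hypothesis w_prim : K.-primitive_root w.
Implicit Types (x y : 'I_K) (g h : 'I_K * 'I_K).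

(** This is X^a Z^b for g = (a, b), where X sends e_j to e_(j+1) and Z multiplies e_j by w^j.
    Exponents are computed in the ring ['I_K], which is harmless as w^K = 1. *)
Definition weyl g : 'M[C]_K :=
  \matrix_(i, j) ((i == j + g.1)%:R * w ^+ ((g.2 * j)%R : 'I_K)).

Lemma weyl_rootD x y : w ^+ ((x + y)%R : 'I_K) = w ^+ x * w ^+ y.
Proof. by rewrite -exprD -[RHS](prim_expr_mod w_prim). Qed.

Lemma weyl_root0 : w ^+ (0%R : 'I_K) = 1.
Proof. by []. Qed.

Lemma weyl_root_norm m : normc (w ^+ m) = 1.
Proof.
apply: (@normc_root_unity _ K) => //.
by rewrite -exprM mulnC exprM (prim_expr_order w_prim) expr1n normc1.
Qed.

Lemma weyl_root_conj x : (w ^+ x)^* = w ^+ ((- x)%R : 'I_K).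
Proof.
have nz : w ^+ x != 0.
  by apply/eqP => E; have := weyl_root_norm x; rewrite E normc0 => /esym/eqP; rewrite oner_eq0.
apply: (mulfI nz); rewrite normc_unit_conj ?weyl_root_norm//.
by rewrite -weyl_rootD subrr weyl_root0.
Qed.

Lemma weyl0 : weyl 0 = 1%:M.
Proof.
apply/matrixP => i j; rewrite !mxE (addr0 j) (mul0r j).
by rewrite expr0 mulr1.
Qed.

(** The phase comes from moving Z^b past X^c: Z^b X^c = w^(bc) X^c Z^b. *)
Lemma weyl_mul g h : weyl g *m weyl h = w ^+ ((g.2 * h.1)%R : 'I_K) *: weyl (g + h).
Proof.
apply/matrixP => i j; rewrite mxE (bigD1 (j + h.1))// [X in _ + X = _]big1 => [|l lj].
  rewrite addr0 !mxE.
  have -> : (g + h).1 = h.1 + g.1 by rewrite addrC.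
  have -> : (g + h).2 = g.2 + h.2 by [].
  rewrite eqxx mul1r addrA -mulrA [RHS]mulrCA -!weyl_rootD.
  by congr (_ * (w ^+ _)); congr (nat_of_ord _); ring.
by rewrite !mxE (negPf lj) mul0r mulr0.
Qed.

Lemma weyl_conj_trmx g : (weyl g)^t* = w ^+ ((g.1 * g.2)%R : 'I_K) *: weyl (- g).
Proof.
apply/matrixP => i j; rewrite !mxE.
have -> (a b : C) : (a * b)^* = a^* * b^* by exact: rmorphM.
rewrite conjC_nat weyl_root_conj mulrCA.
have -> : (- g).1 = - g.1 by [].
have -> : (- g).2 = - g.2 by [].
rewrite [i == _]eq_sym subr_eq; have [->|_] := eqVneq j (i + g.1); last by rewrite !mul0r.
rewrite !mul1r -weyl_rootD; congr (w ^+ _); congr (nat_of_ord _); ring.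
Qed.

(** A nonzero shift leaves the diagonal empty; otherwise the trace is a sum over a nontrivial
    character of Z/K. *)
Lemma weyl_trace g : \tr (weyl g) = (if g == 0 then K%:R else 0).
Proof.
have [->|g0] := eqVneq g 0; first by rewrite weyl0 mxtrace1.
have [g1|g1] := eqVneq g.1 0; last first.
  rewrite /mxtrace big1// => i _; rewrite !mxE -[X in X == _]addr0.
  by rewrite (inj_eq (addrI i)) eq_sym (negPf g1) mul0r.
have g2 : g.2 != 0.
  by apply: contraNneq g0 => g2; apply/eqP; move: g1 g2; case: (g) => a b /= -> ->.
set S := \tr _.
(* Translating the summation index by 1 multiplies the sum by w^(g.2), which differs from 1. *)
have wS : S = w ^+ g.2 * S.
  rewrite {1}/S /mxtrace (reindex_inj (addIr 1)) mulr_sumr/=.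
  apply: eq_bigr => i _; rewrite !mxE g1 !addr0 !eqxx !mul1r -weyl_rootD.
  congr (w ^+ _); congr (nat_of_ord _); ring.
have /eqP : (1 - w ^+ g.2) * S = 0 by rewrite mulrBl mul1r -wS subrr.
rewrite mulf_eq0 subr_eq0 => /orP[|/eqP//].
rewrite eq_sym -(prim_order_dvd w_prim) => /dvdn_leq.
by rewrite lt0n => /(_ g2); rewrite ltnNge -ltnS ltn_ord.
Qed.

(** The product of [weyl g] with the adjoint of [weyl h] is a phase times [weyl (g - h)], whose
    trace is known. *)
Lemma weyl_orthonormal : orthonormal_family weyl.
Proof.
move=> g h; rewrite /ntr_dot weyl_conj_trmx -scalemxAr weyl_mul !mxtraceZ.
rewrite weyl_trace subr_eq0; case: eqVneq => [->|]; last by rewrite !mulr0.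
rewrite mulrA -weyl_rootD [_ + _](_ : _ = 0) ?weyl_root0; last by rewrite /=; ring.
by rewrite mul1r mulVf// pnatr_eq0.
Qed.

Lemma weyl_unitary g : weyl g *m (weyl g)^t* = 1%:M.
Proof.
rewrite weyl_conj_trmx -scalemxAr weyl_mul scalerA subrr weyl0 -weyl_rootD.
by rewrite [_ + _](_ : _ = 0) ?weyl_root0 ?scale1r//=; ring.
Qed.

Lemma weyl_exp g m : exists2 c : C, normc c = 1 & weyl g ^+ m = c *: weyl (g *+ m).
Proof.
elim: m => [|m [c c1 E]]; first by exists 1; rewrite ?normc1// expr0 mulr0n weyl0 scale1r.
exists (c * w ^+ ((g.2 * (g *+ m).1)%R : 'I_K)).
  by rewrite normcM c1 weyl_root_norm mulr1.
by rewrite exprS E -mulmxE -scalemxAr weyl_mul scalerA mulrS.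
Qed.

Lemma pair_mulrn g m : g *+ m = (g.1 *+ m, g.2 *+ m).
Proof. by elim: m => [//|m IH]; rewrite !mulrS IH. Qed.

(* The phase is needed because for even K the K-th power of a Weyl matrix may be -1. *)
Lemma weyl_generator g : exists U : 'M[C]_K,
  [/\ U ^+ K = 1, U *m U^t* = 1%:M &
      forall m, exists2 c : C, normc c = 1 & U ^+ m = c *: weyl (g *+ m)].
Proof.
have [c c1 Ec] := weyl_exp g K.
have gK : g *+ K = 0.
  by rewrite pair_mulrn !Zp_mulrn; congr pair; apply: val_inj; rewrite /= modnMl.
rewrite gK weyl0 in Ec.
(* As K g = 0, the K-th power of [weyl g] is the scalar [c]; the phase [t] is chosen to cancel
   it. *)
pose t := K.-root c^-1.
have tK : t ^+ K = c^-1 by rewrite rootCK.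
have t1 : normc t = 1 by apply: (@normc_root_unity _ K) => //; rewrite tK normcV c1 invr1.
exists (t *: weyl g); split.
- rewrite exprZn tK Ec scalerA mulVf ?scale1r//.
  by apply/eqP => c0; move: c1; rewrite c0 normc0 => /esym/eqP; rewrite oner_eq0.
- rewrite linearZ/= map_mxZ/= -scalemxAl -scalemxAr scalerA weyl_unitary.
  by rewrite normc_unit_conj// scale1r.
- move=> m; have [b b1 Eb] := weyl_exp g m; exists (t ^+ m * b).
    by rewrite normcM normcX t1 expr1n b1 mulr1.
  by rewrite exprZn Eb scalerA.
Qed.

End Weyl.

(** * Comparison with the commutative inequality *)

Lemma cyclic_sum_mul (k : nat) (V : 'M[C]_k.+1) (K : nat) :
  (0 < K)%N -> V ^+ K = 1 ->
  forall m, V ^+ m * (\sum_(i < K) V ^+ i) = \sum_(i < K) V ^+ i.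
Proof.
case: K => // K _ VK; elim=> [|m IH]; first by rewrite expr0 mul1r.
rewrite exprSr -mulrA mulr_sumr [X in _ * X](_ : _ = \sum_(i < K.+1) V ^+ i)//.
rewrite big_ord_recr [RHS]big_ord_recl /= -exprS VK expr0 addrC; congr (_ + _).
by apply: eq_bigr => i _; rewrite -exprS.
Qed.

(* P / K is the orthogonal projection on the fixed vectors of V. *)
Lemma cyclic_sum_projection (k : nat) (V : 'M[C]_k.+1) (K : nat) :
  (0 < K)%N -> V ^+ K = 1 -> V *m V^t* = 1%:M ->
  let P := \sum_(i < K) V ^+ i in P^t* = P /\ P *m P = K%:R *: P.
Proof.
move=> K0 VK VV P; have VP := cyclic_sum_mul K0 VK.
have PP : P *m P = K%:R *: P.
  rewrite mulmxE {1}/P mulr_suml (eq_bigr (fun=> P)) => [|i _]; last exact: VP.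
  by rewrite sumr_const card_ord scaler_nat.
split=> //; set Q := P^t*.
have VX m : (V ^+ m)^t* *m V ^+ m = 1%:M.
  elim: m => [|m IH]; first by rewrite expr0 trmx1 map_mx1 mulmx1.
  by rewrite exprS -mulmxE conj_trmx_mul mulmxA -(mulmxA _ _ V) (mulmx1C VV) mulmx1.
have VQ m : (V ^+ m)^t* *m P = P.
  by rewrite /P -{1}(VP m) -mulmxE mulmxA VX mul1mx.
(* The product Q P is Hermitian by its form, so K P is Hermitian, and therefore P is. *)
have QP : Q *m P = K%:R *: P.
  have -> : Q = \sum_(i < K) (V ^+ i)^t* by rewrite /Q /P raddf_sum raddf_sum.
  rewrite mulmx_suml (eq_bigr (fun=> P)) => [|i _]; last exact: VQ.
  by rewrite sumr_const card_ord scaler_nat.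
have QQP : (Q *m P)^t* = Q *m P by rewrite conj_trmx_mul /Q conj_trmxK.
have KQ : (K%:R *: P)^t* = K%:R *: Q.
  by rewrite linearZ/= map_mxZ/= rmorph_nat.
have : (K%:R : C) *: Q = K%:R *: P by rewrite -KQ -QP.
by move=> /(congr1 (fun M => K%:R^-1 *: M)); rewrite !scalerA mulVf ?scale1r// pnatr_eq0 -lt0n.
Qed.

(** With more than d traceless sites, one of them lies outside S; there the component of A has a
    scalar factor, orthogonal to traceless matrices. *)
Lemma Hledeg_ntr_dot_eq0 K n d (A : 'M[C]_(tensor_dim K n)) (T : 'I_n -> 'M[C]_K) :
  Hledeg d A -> (d < #|[pred j | \tr (T j) == 0%R]|)%N -> ntr_dot A (tensor T) = 0.
Proof.
move=> [AS [hAS ->]] dT; rewrite ntr_dot_suml big1// => S Sd.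
have [m [c [T' [hT ->]]]] := hAS S Sd.
rewrite ntr_dot_suml big1// => l _; rewrite ntr_dotZl ntr_dot_tensor.
have [j] : exists j, (j \in [pred j | \tr (T j) == 0%R]) && (j \notin S).
  apply/existsP; rewrite -negb_forall_in; apply: contraTN dT => /forall_inP TS.
  rewrite -leqNgt (leq_trans _ Sd)// subset_leq_card//.
  by apply/fintype.subsetP => j /TS.
rewrite inE => /andP[/eqP Tj jS]; rewrite (bigD1 j)//=.
have := hT l j; rewrite (negPf jS) => /is_scalar_mxP[s ->].
by rewrite -scalemx1 ntr_dotZl ntr_dot_conj ntr_dot1r Tj mulr0 rmorph0 !mulr0 mul0r mulr0.
Qed.

Lemma cyc_max_le K N (f : ('I_N -> C) -> C) (b : R) :
  (forall x, cyc_group K x -> normc (f x) <= b) -> cyc_max K f <= b.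
Proof.
move=> fb; apply: ge_sup; first by exists (normc (f (fun=> 1))), (fun=> 1); rewrite //= => j; rewrite expr1n.
by move=> _ [x xK <-]; exact: fb.
Qed.

(** Expanding the tensor product of the cyclic sums [P j] recovers the polynomial at x. This tensor
    is K^n times a projection and has trace K^n, because only the zeroth power of each [U j]
    contributes to the trace. *)
Lemma cyc_poly_le_op_norm k n (U : 'I_n -> 'M[C]_k.+2)
    (A : 'M[C]_(tensor_dim k.+2 n)) (x : 'I_n -> C) :
  (forall j, U j ^+ k.+2 = 1) -> (forall j, U j *m (U j)^t* = 1%:M) ->
  (forall j (m : 'I_k.+2), m != 0 -> \tr (U j ^+ m) = 0) ->
  cyc_group k.+2 x ->
  normc (cyc_poly (fun m : {ffun 'I_n -> 'I_k.+2} =>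
    ntr_dot A (tensor (fun j => U j ^+ m j))) x) <= op_norm A.
Proof.
move=> UK UU Utr xK.
(* The conjugate makes the fixed vectors of [V j] the eigenvectors of [U j] for [x j], and offsets
   the conjugation in the second argument of [ntr_dot]. *)
pose V j := (x j)^* *: U j.
have x1 j : normc (x j) = 1.
  by apply: (@normc_root_unity _ k.+2) => //; rewrite xK normc1.
have VK j : V j ^+ k.+2 = 1.
  by rewrite exprZn UK -rmorphXn/= xK rmorph1 scale1r.
have VV j : V j *m (V j)^t* = 1%:M.
  rewrite linearZ/= map_mxZ/= -scalemxAl -scalemxAr scalerA UU conjCK mulrC.
  by rewrite normc_unit_conj// scale1r.
pose P j := \sum_(i < k.+2) V j ^+ i.
have Pj j : (P j)^t* = P j /\ P j *m P j = k.+2%:R *: P j.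
  exact: (@cyclic_sum_projection _ (V j) k.+2).
have trP j : \tr (P j) = k.+2%:R.
  rewrite raddf_sum big_ord_recl big1 /= ?addr0 ?mxtrace1// => i _.
  by rewrite exprZn mxtraceZ (Utr j (lift ord0 i)) ?mulr0.
have -> : cyc_poly (fun m : {ffun 'I_n -> 'I_k.+2} =>
    ntr_dot A (tensor (fun j => U j ^+ m j))) x = ntr_dot A (tensor P).
  rewrite tensor_sum ntr_dot_sumr; apply: eq_bigr => m _.
  rewrite mulrC -[cyc_char m x]conjCK -ntr_dotZr; congr ntr_dot.
  rewrite /cyc_char rmorph_prod -tensor_scale; apply: eq_tensor => j.
  by rewrite exprZn rmorphXn.
apply: (@ntr_dot_le_op_norm _ (k.+2 ^ n)).
- by rewrite tensor_dimE expn_gt0.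
- by rewrite expn_gt0.
- by rewrite tensor_conj_trmx; apply: eq_tensor => j; have [] := Pj j.
- rewrite tensor_mul (eq_tensor (fun j => (Pj j).2)) tensor_scale.
  by rewrite prodr_const card_ord natrX.
- by rewrite tensor_trace (eq_bigr _ (fun j _ => trP j)) prodr_const card_ord tensor_dimE natrX.
Qed.

(** The admissibility condition in [bh_supp], for one real c. Estimates are proved for each
    admissible c, and the infimum, possibly infinite, is taken only at the end. *)
Definition bh_supp_bound d K (c : R) : Prop :=
  forall (N : nat) (a : {ffun 'I_N -> 'I_K} -> C),
    (1 <= N)%N ->
    (forall m : {ffun 'I_N -> 'I_K},
       (d < #|[set j | m j != 0 :> nat]|)%N -> a m = 0) ->
    lp_norm (bh_exp R d) a <= c * cyc_max K (cyc_poly a).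

Lemma bh_exp_gt0 d : (0 < d)%N -> 0 < bh_exp R d.
Proof. by move=> d0; rewrite divr_gt0// ltr0n// muln_gt0. Qed.

Lemma lp_norm_ge0 (I : finType) p (a : I -> C) : 0 <= lp_norm p a.
Proof. exact: powR_ge0. Qed.

Lemma lp_norm_powR (I : finType) p (a : I -> C) : p != 0 ->
  lp_norm p a `^ p = \sum_i normc (a i) `^ p.
Proof.
move=> p0; rewrite /lp_norm -powRrM mulVf// powRr1//.
by apply: sumr_ge0 => i _; exact: powR_ge0.
Qed.

(** The set-builder denotes a classical set here, with membership decided by [asbool]; the lemma
    returns to the boolean predicate. *)
Lemma card_mkset (T : finType) (P : pred T) : #|[set x | P x]| = #|P|.
Proof. by apply: eq_card => x; rewrite -[LHS]/`[< P x >] asboolb. Qed.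

(** The constant polynomial 1 in one variable has maximum 1, and the left side of its inequality is
    nonnegative. *)
Lemma bh_supp_bound_ge0 d k c : bh_supp_bound d k.+2 c -> 0 <= c.
Proof.
move=> hc; pose a (m : {ffun 'I_1 -> 'I_k.+2}) : C := (m == [ffun=> ord0])%:R.
have f1 x : cyc_poly a x = 1.
  rewrite /cyc_poly (bigD1 [ffun=> ord0])//= big1 ?addr0 => [|m /negPf m0].
    by rewrite /a eqxx mul1r /cyc_char big1// => j _; rewrite ffunE expr0.
  by rewrite /a m0 mul0r.
have := hc 1%N a isT; rewrite (_ : cyc_max _ _ = 1) ?mulr1; last first.
  rewrite /cyc_max [X in sup X](_ : _ = [set 1]) ?sup1//.
  apply/seteqP; split=> [_ [x _ <-]|_ ->]; first by rewrite f1 normc1.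
  by exists (fun=> 1); rewrite ?f1 ?normc1//= => j; rewrite expr1n.
move=> H; apply: le_trans (lp_norm_ge0 _ _) (H _) => m.
rewrite /a; case: eqVneq => [->|//]; rewrite card_mkset eq_card0// => j.
by rewrite -topredE /= ffunE.
Qed.

Lemma commutative_bound k n d (U : 'I_n -> 'M[C]_k.+2)
    (A : 'M[C]_(tensor_dim k.+2 n)) (c : R) :
  (1 <= n)%N -> (0 < d)%N ->
  (forall j, U j ^+ k.+2 = 1) -> (forall j, U j *m (U j)^t* = 1%:M) ->
  (forall j (m : 'I_k.+2), m != 0 -> \tr (U j ^+ m) = 0) ->
  Hledeg d A -> bh_supp_bound d k.+2 c ->
  \sum_(m : {ffun 'I_n -> 'I_k.+2})
     normc (ntr_dot A (tensor (fun j => U j ^+ m j))) `^ bh_exp R d <=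
  (c * op_norm A) `^ bh_exp R d.
Proof.
move=> n1 d0 UK UU Utr hA hc.
pose a (m : {ffun 'I_n -> 'I_k.+2}) := ntr_dot A (tensor (fun j => U j ^+ m j)).
have p0 := bh_exp_gt0 d0; rewrite -lp_norm_powR ?gt_eqF//.
have c0 := bh_supp_bound_ge0 hc.
rewrite ge0_ler_powR ?nnegrE ?(ltW p0) ?lp_norm_ge0 ?mulr_ge0 ?op_norm_ge0//.
apply: (@le_trans _ _ (c * cyc_max k.+2 (cyc_poly a))).
  apply: (hc n a n1) => m dm.
  apply: (Hledeg_ntr_dot_eq0 hA); rewrite card_mkset in dm.
  apply: leq_trans dm _; apply: subset_leq_card.
  by apply/fintype.subsetP => j; rewrite inE -topredE /= => mj; rewrite Utr.
rewrite ler_wpM2l//; apply: cyc_max_le => x xK.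
exact: cyc_poly_le_op_norm.
Qed.

(** * Averaging over cyclic subgroups *)

(** The arithmetic cover moved to pairs in ['I_k.+2]; the middle clause says that every generator
    has full order. *)
Lemma cyclic_cover k : exists (M : nat) (gen : 'I_M -> 'I_k.+2 * 'I_k.+2),
  [/\ M%:R = dedekind_psi R k.+2,
      forall l m, gen l *+ m = 0 -> (k.+2 %| m)%N &
      forall h, exists l, exists t : 'I_k.+2, gen l *+ t = h].
Proof.
have [s [ps cs] sz] := dedekind_psi_cover R (ltn0Sn k.+1).
pose gen (l : 'I_(size s)) : 'I_k.+2 * 'I_k.+2 :=
  (inZp (nth (0, 0)%N s l).1, inZp (nth (0, 0)%N s l).2).
have inZpM a m : (inZp a : 'I_k.+2) *+ m = inZp (m * a).
  by rewrite Zp_mulrn; apply: val_inj; rewrite /= modnMml mulnC.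
exists (size s), gen; split=> // [l m|h].
  rewrite pair_mulrn !inZpM => -[e1 e2].
  by apply: (ps (nth (0, 0)%N s l)); rewrite ?mem_nth//; apply/eqP.
have [g gs [t [t1 t2]]] := cs h.1 h.2.
have ls : (index g s < size s)%N by rewrite index_mem.
exists (Ordinal ls), (inZp t); rewrite pair_mulrn !inZpM /= nth_index//.
have inZp_val (x : 'I_k.+2) a : x = a %[mod k.+2] -> inZp (a %% k.+2) = x.
  by move=> <-; apply: val_inj; rewrite /= modn_mod modn_small.
case: h t1 t2 => a b /= t1 t2; congr pair; apply: val_inj => /=.
  by rewrite modnMml -t1 modn_small.
by rewrite modnMml -t2 modn_small.
Qed.

Lemma tensor_phase K n (A : 'M[C]_(tensor_dim K n)) (S T : 'I_n -> 'M[C]_K) :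
  (forall j, exists2 c : C, normc c = 1 & S j = c *: T j) ->
  normc (ntr_dot A (tensor S)) = normc (ntr_dot A (tensor T)).
Proof.
move=> ST; have /choice[c hc] j : exists c : C, normc c = 1 /\ S j = c *: T j.
  by have [c c1 E] := ST j; exists c.
rewrite (eq_tensor (fun j => (hc j).2)) tensor_scale ntr_dotZr normcM normc_conj.
by rewrite normc_prod big1 ?mul1r// => j _; have [] := hc j.
Qed.

(** Double counting: the sum of the hypothesis over all |L|^n choices [f] is compared with the sum
    of F weighted by numbers of representations. *)
Lemma sum_cover_average n d (L T G : finType) (z : G) (act : L -> T -> G)
    (F : {ffun 'I_n -> G} -> R) (X : R) :
  (0 < #|L|)%N -> (forall h, exists l, exists t, act l t = h) ->
  (forall l, exists t, act l t = z) -> (forall g, 0 <= F g) ->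
  (forall g, (d < #|fsupport z g|)%N -> F g = 0) ->
  (forall f : {ffun 'I_n -> L},
     \sum_(m : {ffun 'I_n -> T}) F [ffun j => act (f j) (m j)] <= X) ->
  \sum_g F g <= #|L|%:R ^+ d * X.
Proof.
move=> L0 act_cov act_z F0 Fd sumX; set M := #|L|.
have M1 : 1 <= (M%:R : R) by rewrite ler1n.
pose pt (f : {ffun 'I_n -> L}) (m : {ffun 'I_n -> T}) := [ffun j => act (f j) (m j)].
(* nu h counts the representations of h; each tuple g is represented by at least
   #|L| ^ (n - #|support g|) pairs, since every l represents z. *)
pose nu h : R := \sum_l \sum_t (act l t == h)%:R.
have nu_ge1 h : 1 <= nu h.
  have [l [t E]] := act_cov h; rewrite /nu (bigD1 l)//= (bigD1 t)//= E eqxx -addrA lerDl.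
  by rewrite addr_ge0// ?sumr_ge0// => i _; rewrite sumr_ge0.
have nu0 : M%:R <= nu z.
  rewrite /M -sum1_card natr_sum; apply: ler_sum => l _.
  have [t E] := act_z l; rewrite (bigD1 t)//= E eqxx lerDl sumr_ge0//.
have countE g : \sum_f \sum_m (pt f m == g)%:R = \prod_j nu (g j).
  rewrite bigA_distr_bigA; apply: eq_bigr => f _.
  rewrite bigA_distr_bigA; apply: eq_bigr => m _.
  case: eqP => [<-|ne].
    by rewrite big1// => j _; rewrite ffunE eqxx.
  have [j] : exists j, act (f j) (m j) != g j.
    apply/existsP; rewrite -negb_forall; apply/negP => /forallP E; apply: ne.
    by apply/ffunP => j; rewrite ffunE; exact/eqP.
  by move=> /negPf jn; rewrite (bigD1 j)//= jn mul0r.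
have doubleE : \sum_f \sum_m F (pt f m) = \sum_g F g * \prod_j nu (g j).
  transitivity (\sum_f \sum_m \sum_g F g * (pt f m == g)%:R).
    apply: eq_bigr => f _; apply: eq_bigr => m _.
    rewrite (bigD1 (pt f m))//= eqxx mulr1 big1 ?addr0// => g.
    by rewrite eq_sym => /negPf ->; rewrite mulr0.
  rewrite (eq_bigr _ (fun f _ => exchange_big _ _ _ _ _ _))/= exchange_big/=.
  apply: eq_bigr => g _; rewrite -countE mulr_sumr; apply: eq_bigr => f _.
  by rewrite mulr_sumr.
(* Both sides are kept multiplied out to avoid the exponent n - d. Site by site, M <= M nu on the
   support and M <= nu off it. *)
have key g : M%:R ^+ n * F g <= M%:R ^+ d * (F g * \prod_j nu (g j)).
  have [gd|gd] := leqP #|fsupport z g| d; last by rewrite Fd// mul0r !mulr0.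
  rewrite [M%:R ^+ d * _]mulrCA mulrC ler_wpM2l//.
  rewrite (@le_trans _ _ (M%:R ^+ #|fsupport z g| * \prod_j nu (g j)))//; last first.
    by rewrite ler_wpM2r ?ler_weXn2l// prodr_ge0// => j _; exact: le_trans (nu_ge1 _).
  have -> : (M%:R : R) ^+ n = \prod_(j < n) M%:R by rewrite prodr_const card_ord.
  rewrite -prodr_const [X in _ <= X * _]big_mkcond -big_split/=; apply: ler_prod => j _.
  rewrite ler0n/= inE; case: eqVneq => [->|_] /=; first by rewrite mul1r.
  by rewrite ler_peMr// ler0n.
have Mn0 : 0 < (M%:R : R) ^+ n by rewrite exprn_gt0// ltr0n.
rewrite -(ler_pM2l Mn0) mulr_sumr (le_trans (ler_sum _ (fun g _ => key g)))//.
rewrite -mulr_sumr -doubleE mulrCA ler_wpM2l ?exprn_ge0//.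
rewrite (le_trans (ler_sum _ (fun f _ => sumX f)))//.
by rewrite sumr_const card_ffun card_ord -natrX mulr_natl.
Qed.

Lemma weyl_bound k n d (w : C) (A : 'M[C]_(tensor_dim k.+2 n)) (c : R) :
  k.+2.-primitive_root w -> (1 <= n)%N -> (0 < d)%N ->
  Hledeg d A -> bh_supp_bound d k.+2 c ->
  \sum_(g : {ffun 'I_n -> 'I_k.+2 * 'I_k.+2})
     normc (tensor_coef (weyl w) A g) `^ bh_exp R d <=
  dedekind_psi R k.+2 ^+ d * (c * op_norm A) `^ bh_exp R d.
Proof.
move=> wp n1 d0 hA hc; have [M [gen [<- gen_prim gen_cov]]] := cyclic_cover k.
have p0 := bh_exp_gt0 d0.
have /choice[U hU] l := weyl_generator wp (gen l).
have := @sum_cover_average n d 'I_M 'I_k.+2 ('I_k.+2 * 'I_k.+2)%type (0 : 'I_k.+2 * 'I_k.+2)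
  (fun l t => gen l *+ t) (fun g => normc (tensor_coef (weyl w) A g) `^ bh_exp R d).
rewrite card_ord; apply => //.
- by have [[m hm] _] := gen_cov 0; exact: leq_ltn_trans hm.
- by move=> l; exists ord0.
- by move=> g; exact: powR_ge0.
- move=> g gd; rewrite /tensor_coef (Hledeg_ntr_dot_eq0 hA) ?normc0 ?powR0 ?gt_eqF//.
  apply: leq_trans gd _; apply: subset_leq_card; apply/fintype.subsetP => j.
  by rewrite !inE weyl_trace// => /negPf ->.
move=> f.
have UK j : U (f j) ^+ k.+2 = 1 by have [] := hU (f j).
have UU j : U (f j) *m (U (f j))^t* = 1%:M by have [] := hU (f j).
apply: le_trans (@commutative_bound k n d (fun j => U (f j)) A c n1 d0 UK UU _ hA hc).
  apply: ler_sum => m _; rewrite le_eqVlt; apply/orP; left; apply/eqP.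
  congr (_ `^ _); apply/esym/tensor_phase => j.
  by have [_ _ /(_ (m j))] := hU (f j); rewrite ffunE.
(* The m-th power is a phase times a Weyl matrix whose index is nonzero, as the generator has order
   K and 0 < m < K. *)
move=> j m m0; have [_ _ /(_ m)[b _ ->]] := hU (f j); rewrite mxtraceZ weyl_trace//.
case: eqP => [/gen_prim|_]; last by rewrite mulr0.
by move=> /dvdn_leq; rewrite lt0n => /(_ m0); rewrite leqNgt ltn_ord.
Qed.

(** * Change of basis *)

(** The indicator of a given support is a product over the sites, so the count is a product of
    one-site counts, |I| - 1 on S and 1 off S. *)
Lemma card_fsupport n (I : finType) (i0 : I) (S : {set 'I_n}) :
  #|[pred b : {ffun 'I_n -> I} | fsupport i0 b == S]| = (#|I|.-1 ^ #|S|)%N.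
Proof.
rewrite -prod_nat_const [RHS]big_mkcond -[LHS]sum1_card.
have -> : (\prod_(j < n) (if j \in S then #|I|.-1 else 1) =
    \prod_(j < n) \sum_(i : I) ((i != i0) == (j \in S) : nat))%N.
  apply: eq_bigr => j _; case: (j \in S).
    rewrite -(cardC1 i0) -sum1_card big_mkcond; apply: eq_bigr => i _.
    by rewrite inE eqb_id; case: (i != i0).
  by rewrite (bigD1 i0)//= eqxx big1// => i /negPf ->.
rewrite bigA_distr_bigA big_mkcond; apply: eq_bigr => b _; rewrite inE.
case: eqP => [<-|ne].
  by rewrite big1// => j _; rewrite inE eqxx.
have [j] : exists j, (b j != i0) != (j \in S).
  apply/existsP; rewrite -negb_forall; apply/negP => /forallP E; apply: ne.
  by apply/finset.setP => j; rewrite inE (eqP (E j)).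
by move=> /negPf jn; rewrite (bigD1 j)//= jn mul0n.
Qed.

Lemma bh_exp_half d : bh_exp R d / 2 = d%:R / d.+1%:R.
Proof. by rewrite /bh_exp natrM mulrAC [2 * _]mulrC mulfK// pnatr_eq0. Qed.

Lemma normc_powR (z : C) (p : R) : normc z `^ p = (normc z ^+ 2) `^ (p / 2).
Proof. by rewrite -powR_mulrn ?normc_ge0// -powRrM mulrCA mulfV ?mulr1// pnatr_eq0. Qed.

(** On each block of support S the chain is: l_p to l_2 by concavity, [block_parseval], then l_2
    back to l_p. Blocks with |S| > d vanish. *)
Lemma basis_change_lp K n d (I J : finType) (B : I -> 'M[C]_K) (W : J -> 'M[C]_K)
    (i0 : I) (j0 : J) (A : 'M[C]_(tensor_dim K n)) :
  (1 < K)%N -> (0 < d)%N -> #|I| = (K * K)%N -> #|J| = (K * K)%N ->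
  orthonormal_family B -> orthonormal_family W -> B i0 = 1%:M -> W j0 = 1%:M ->
  Hledeg d A ->
  \sum_(b : {ffun 'I_n -> I}) normc (tensor_coef B A b) `^ bh_exp R d <=
  Num.sqrt ((K ^ 2 - 1)%N%:R : R) `^ bh_exp R d *
    \sum_(g : {ffun 'I_n -> J}) normc (tensor_coef W A g) `^ bh_exp R d.
Proof.
move=> K1 d0 cI cJ oB oW B0 W0 hA.
have K0 : (0 < K)%N by exact: ltnW.
have N1 : (0 < K ^ 2 - 1)%N by rewrite subn_gt0 -{1}(exp1n 2) ltn_exp2r.
have N1R : 1 <= ((K ^ 2 - 1)%N%:R : R) by rewrite ler1n.
have p0 := bh_exp_gt0 d0; set p := bh_exp R d in p0 *.
have d1 : 0 < (d.+1%:R : R) by rewrite ltr0n.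
have q01 : 0 < p / 2 < 1.
  by rewrite bh_exp_half divr_gt0 ?ltr0n//= ltr_pdivrMr// mul1r ltr_nat.
have q01' : 0 < p / 2 <= 1 by case/andP: q01 => -> /ltW.
have coef0 b : (d < #|fsupport i0 b|)%N -> tensor_coef B A b = 0.
  move=> db; apply: (Hledeg_ntr_dot_eq0 hA).
  apply: leq_trans db _; apply: subset_leq_card; apply/fintype.subsetP => j.
  rewrite !inE => bj; have := oB (b j) i0; rewrite B0 ntr_dot1r (negPf bj).
  by move=> /eqP; rewrite mulf_eq0 invr_eq0 pnatr_eq0 eqn0Ngt K0.
rewrite (partition_big (fsupport i0) xpredT)//= [X in _ <= _ * X](partition_big (fsupport j0) xpredT)//=.
rewrite mulr_sumr; apply: ler_sum => S _.
have G0 : 0 <= \sum_(g | fsupport j0 g == S) normc (tensor_coef W A g) `^ p.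
  by apply: sumr_ge0 => g _; exact: powR_ge0.
have [Sd|Sd] := leqP #|S| d; last first.
  rewrite big1 ?mulr_ge0 ?powR_ge0// => b /eqP bS.
  by rewrite coef0 ?bS// normc0 powR0// gt_eqF.
under eq_bigr => b _ do rewrite normc_powR.
rewrite (le_trans (sum_powR_le _ q01 _))//; first by move=> b; exact: sqr_ge0.
rewrite (block_parseval (j0 := j0) A S K0 cI cJ oB oW) ?B0//.
rewrite card_fsupport cI mulnn -subn1 natrX.
apply: ler_pM; rewrite ?powR_ge0//; last first.
  rewrite (le_trans (sum_powR_ge _ q01' _))//; first by move=> b; exact: sqr_ge0.
  by apply: ler_sum => g _; rewrite -normc_powR.
(* With N = K^2 - 1 the exponents of N compare as |S| (1 - p/2) = |S|/(d+1) <= d/(d+1) = p/2. *)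
rewrite -powR_mulrn ?ler0n// -powRrM -powR12_sqrt ?ler0n// -powRrM mulrC.
rewrite ler_powR// [2^-1 * _]mulrC bh_exp_half.
have -> : 1 - (d%:R / d.+1%:R : R) = d.+1%:R^-1.
  by apply: (mulIf (lt0r_neq0 d1)); rewrite mulrBl mul1r divfK ?gt_eqF// mulVf ?gt_eqF// -natr1 addrAC subrr add0r.
by rewrite mulrC ler_wpM2r ?invr_ge0 ?ler0n// ler_nat.
Qed.

Lemma dedekind_psi_ge1 K : (0 < K)%N -> 1 <= dedekind_psi R K.
Proof.
move=> K0; have one_le_mul (x y : R) : 1 <= x -> 1 <= y -> 1 <= x * y.
  by move=> x1 y1; rewrite -[leLHS]mulr1 ler_pM.
apply: (one_le_mul); first by rewrite ler1n.
elim: (primes K) => [|p ps IH]; first by rewrite big_nil.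
rewrite big_cons one_le_mul//.
by rewrite lerDl invr_ge0.
Qed.

Lemma local_coef_bound K n d (B : 'I_(K ^ 2) -> 'M[C]_K)
    (A : 'M[C]_(tensor_dim K n)) (c : R) :
  (2 <= K)%N -> (1 <= d)%N -> (1 <= n)%N -> normalized_local_basis B ->
  Hledeg d A -> bh_supp_bound d K c ->
  lp_norm (bh_exp R d) (local_coef B A) <=
  Num.sqrt ((K ^ 2 - 1)%N%:R : R) * dedekind_psi R K ^+ d * (c * op_norm A).
Proof.
case: K B A => [//|[//|k]] B A _ d0 n1 [B1 oB _] hA hc.
have [w wp] := primitive_root_exists (ltn0Sn k.+1).
have K2 : (0 < k.+2 ^ 2)%N by rewrite expn_gt0.
have p0 := bh_exp_gt0 d0; set p := bh_exp R d in p0 *.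
have p1 : 1 <= p.
  by rewrite /p /bh_exp ler_pdivlMr ?ltr0n// mul1r ler_nat mul2n -addnn -addn1 leq_add2l.
have psi1 := dedekind_psi_ge1 (ltn0Sn k.+1).
have c0 := bh_supp_bound_ge0 hc.
have H := @basis_change_lp k.+2 n d _ _ B (weyl w) (Ordinal K2) 0 A isT d0.
have cI : #|'I_(k.+2 ^ 2)| = (k.+2 * k.+2)%N by rewrite card_ord mulnn.
have cJ : #|{: 'I_k.+2 * 'I_k.+2}| = (k.+2 * k.+2)%N by rewrite card_prod card_ord.
have {}H := H cI cJ oB (weyl_orthonormal wp) (B1 (Ordinal K2) erefl) (weyl0 k w) hA.
set r := Num.sqrt _ in H *; have r0 : 0 <= r by exact: sqrtr_ge0.
have {}H := le_trans H (ler_wpM2l (powR_ge0 _ _) (weyl_bound wp n1 d0 hA hc)).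
set Y := r * _ * _.
have Y0 : 0 <= Y by rewrite !mulr_ge0 ?op_norm_ge0 ?exprn_ge0// (le_trans ler01 psi1).
rewrite -[leRHS](powRr1 Y0) -(mulfV (lt0r_neq0 p0)) powRrM /lp_norm -/p.
rewrite ge0_ler_powR ?nnegrE ?invr_ge0 ?(ltW p0) ?powR_ge0//.
  by apply: sumr_ge0 => b _; exact: powR_ge0.
apply: le_trans H _; rewrite -/p /Y -mulrA !powRM ?mulr_ge0 ?op_norm_ge0 ?exprn_ge0 ?(le_trans ler01 psi1)//.
(* The averaging factor psi^d stands outside the p-th power; it is at most its own p-th power
   because psi^d >= 1 and p >= 1. *)
rewrite ler_wpM2l ?powR_ge0// ler_wpM2r ?mulr_ge0 ?powR_ge0// le1r_powR//.
by rewrite exprn_ege1.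
Qed.

End ComplexMatrices.

(** * The constants *)

Lemma bernoulli_ineq (R : realType) (e : R) n : 0 <= e -> 1 + n%:R * e <= (1 + e) ^+ n.
Proof.
move=> e0; elim: n => [|n IH]; first by rewrite mul0r addr0 expr0.
rewrite exprS (le_trans _ (ler_wpM2l (addr_ge0 ler01 e0) IH))//.
rewrite -natr1 mulrDl mul1r mulrDl mul1r mulrDr mulr1 addrA -!addrA lerD2l.
by rewrite lerD2l lerDl !mulr_ge0.
Qed.

(** By Bernoulli, r <= d e <= (1 + e)^d as soon as d >= r/e. *)
Lemma nth_root_near_one (R : realType) (r e : R) : 0 <= r -> 0 < e ->
  exists N, forall d, (N <= d)%N -> (0 < d)%N -> r `^ d%:R^-1 <= 1 + e.
Proof.
move=> r0 e0; have re0 : 0 <= r / e by rewrite divr_ge0// ltW.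
exists (Num.bound (r / e)) => d Nd d0.
have dR : 0 < (d%:R : R) by rewrite ltr0n.
have e1 : 0 <= 1 + e by rewrite addr_ge0// ltW.
have rd : r <= (1 + e) ^+ d.
  rewrite (le_trans _ (bernoulli_ineq d (ltW e0)))// (@le_trans _ _ (d%:R * e)) ?lerDr//.
  by rewrite -ler_pdivrMr// (le_trans (ltW (archi_boundP re0)))// ler_nat.
rewrite (@le_trans _ _ (((1 + e) ^+ d) `^ d%:R^-1))//.
  by rewrite ge0_ler_powR ?nnegrE ?invr_ge0 ?(ltW dR) ?exprn_ge0.
by rewrite -powR_mulrn// -powRrM mulfV ?gt_eqF// powRr1.
Qed.

Section Constants.
Variables (R : realType) (K : nat).
Hypothesis K2 : (2 <= K)%N.
Local Notation C := R[i].

Definition bh_factor d : R := Num.sqrt ((K ^ 2 - 1)%N%:R : R) * dedekind_psi R K ^+ d.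

Lemma sqrt_dim_gt0 : 0 < Num.sqrt ((K ^ 2 - 1)%N%:R : R).
Proof. by rewrite sqrtr_gt0 ltr0n subn_gt0 -{1}(exp1n 2) ltn_exp2r. Qed.

Lemma bh_factor_gt0 d : 0 < bh_factor d.
Proof.
rewrite mulr_gt0 ?sqrt_dim_gt0 ?exprn_gt0//.
by rewrite (lt_le_trans ltr01)// dedekind_psi_ge1// ltnW.
Qed.

Lemma bh_supp_ge0 d : (0 <= bh_supp R d K)%E.
Proof.
apply: le_ereal_inf_tmp => _ [c hc <-]; rewrite lee_fin.
by case: K K2 hc => [//|[//|k]] _ hc; exact: (@bh_supp_bound_ge0 R d k c hc).
Qed.

Lemma local_coef_ebound d n (B : 'I_(K ^ 2) -> 'M[C]_K)
    (A : 'M[C]_(tensor_dim K n)) :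
  (1 <= d)%N -> (1 <= n)%N -> normalized_local_basis B -> Hledeg d A ->
  ((lp_norm (bh_exp R d) (local_coef B A))%:E <=
     (bh_factor d)%:E * bh_supp R d K * (op_norm A)%:E)%E.
Proof.
move=> d0 n0 hB hA; have f0 := bh_factor_gt0 d.
(* If the norm is 0, the right side is 0 even for an infinite constant, and A = 0. Otherwise
   division shows that the quotient is a lower bound of all admissible constants. *)
have [A0|A0] := eqVneq (op_norm A) 0.
  rewrite A0 mule0 lee_fin (op_norm_eq0 A0) /lp_norm big1 => [|b _].
    by rewrite powR0// invr_eq0 gt_eqF// bh_exp_gt0.
  by rewrite /local_coef ntr_dot0l normc0 powR0// gt_eqF// bh_exp_gt0.
have {}A0 : 0 < op_norm A by rewrite lt_neqAle eq_sym A0 op_norm_ge0.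
have fA0 : 0 < bh_factor d * op_norm A by exact: mulr_gt0.
set L := lp_norm _ _.
have H : ((L / (bh_factor d * op_norm A))%:E <= bh_supp R d K)%E.
  apply: le_ereal_inf_tmp => _ [c hc <-]; rewrite lee_fin ler_pdivrMr//.
  by rewrite mulrCA; exact: (local_coef_bound K2 d0 n0 hB hA hc).
rewrite muleAC -EFinM.
have -> : (L%:E = (bh_factor d * op_norm A)%:E * (L / (bh_factor d * op_norm A))%:E)%E.
  by rewrite -EFinM mulrC divfK// gt_eqF.
by rewrite lee_pmul2l ?fin_numE ?lte_fin.
Qed.

Lemma Hdeg_Hledeg d n (A : 'M[C]_(tensor_dim K n)) : Hdeg d A -> Hledeg d A.
Proof.
move=> [AS [hAS ->]].
exists (fun S : {set 'I_n} => if #|S| == d then AS S else 0); split=> [S _|].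
  case: ifP => [Sd|_]; first exact: hAS.
  (* The components of degree below d are zero, written as an empty combination of pure tensors. *)
  exists 0%N, (fun=> 0), (fun _ _ => 0); rewrite big_ord0; split=> // -[].
  by [].
rewrite -big_mkcondr; apply: eq_bigl => S.
by case: eqP => [->|_]; rewrite ?leqnn ?andbF.
Qed.

Lemma bh_const_le d b : (1 <= d)%N -> bh_supp R d K = b%:E ->
  (bh_const R d K <= (bh_factor d * b)%:E)%E.
Proof.
move=> d0 Eb; apply: ereal_inf_lbound; exists (bh_factor d * b) => //= n B A n0 hB hA.
by have := local_coef_ebound d0 n0 hB (Hdeg_Hledeg hA); rewrite Eb -!EFinM lee_fin.
Qed.

(* A negative real has powR equal to 1, whence the maximum. *)
Lemma poweR_le_max (x : \bar R) (y r : R) : 0 < r -> 0 <= y -> (x <= y%:E)%E ->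
  (poweR x r <= (Num.max 1 (y `^ r))%:E)%E.
Proof.
move=> r0 y0; case: x => [x| |] xy.
- rewrite poweR_EFin lee_fin le_max; have [x0|x0] := leP 0 x.
    by rewrite ge0_ler_powR ?nnegrE ?(ltW r0) ?orbT// -lee_fin.
  by rewrite lt0_powR1// lexx.
- by move: xy; rewrite leye_eq.
- by rewrite poweRNyr ?gt_eqF// lee_fin le_max ler01.
Qed.

Lemma limn_esup_le (u : nat -> \bar R) (l : \bar R) N :
  (forall d, (N <= d)%N -> (u d <= l)%E) -> (limn_esup u <= l)%E.
Proof.
move=> ul; apply: (@le_trans _ _ (ereal_sup [set u d | d in [set d | (N <= d)%N]])).
  by apply: ereal_inf_lbound; exists [set d | (N <= d)%N] => //; exists N.
by apply: ge_ereal_sup => _ [d Nd <-]; exact: ul.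
Qed.

Lemma limn_esup_lt (u : nat -> \bar R) (l : \bar R) :
  (limn_esup u < l)%E -> exists N, forall d, (N <= d)%N -> (u d < l)%E.
Proof.
move=> /ereal_inf_lt[_ [V [N _ NV] <-] ul]; exists N => d Nd.
by apply: le_lt_trans ul; apply: ereal_sup_ubound; exists d => //; exact: NV.
Qed.

Lemma bh_growth_le :
  (limn_esup (fun d : nat => poweR (bh_supp R d K) d%:R^-1) <= 1)%E ->
  (bh_growth R K <= (dedekind_psi R K)%:E)%E.
Proof.
move=> hs; have psi1 := dedekind_psi_ge1 R (ltnW K2).
set psi := dedekind_psi R K in psi1 *; have psi0 : 0 < psi := lt_le_trans ltr01 psi1.
apply/lee_addgt0Pr => e e0; rewrite -EFinD.
(* As t <= 1, psi (1 + t)^2 <= psi + 3 psi t <= psi + e. One factor 1 + t absorbs the d-th root of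
   the dimension constant, the other that of the commutative constant. *)
pose t := Num.min 1 (e / (3 * psi)).
have psi3 : 0 < 3 * psi by rewrite mulr_gt0.
have t0 : 0 < t by rewrite lt_min ltr01 divr_gt0.
have t1 : t <= 1 by rewrite ge_min lexx.
have te : t * (3 * psi) <= e by rewrite -(ler_pdivlMr _ _ psi3) /t ge_min lexx orbT.
have bnd : psi * (1 + t) * (1 + t) <= psi + e.
  have tt : t * t <= t := ler_piMr (ltW t0) t1.
  have := ler_wpM2l (ltW psi0) tt; lra.
have [N1 hN1] : exists N, forall d, (N <= d)%N ->
    (poweR (bh_supp R d K) d%:R^-1 < (1 + t)%:E)%E.
  by apply: limn_esup_lt; apply: le_lt_trans hs _; rewrite lte_fin ltrDl.
have [N2 hN2] := nth_root_near_one (sqrtr_ge0 ((K ^ 2 - 1)%N%:R : R)) t0.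
apply: (@limn_esup_le _ _ (maxn (maxn N1 N2) 1)) => d.
rewrite !geq_max => /andP[/andP[d1 d2] d0].
have di0 : 0 < (d%:R^-1 : R) by rewrite invr_gt0 ltr0n.
have {}hN1 := hN1 d d1; have {}hN2 := hN2 d d2 d0.
have b0 := bh_supp_ge0 d.
(* Nonnegativity excludes the value -oo; +oo is excluded since its d-th root is again +oo. *)
case Eb : (bh_supp R d K) b0 hN1 => [b| |] b0 hN1; last by [].
- rewrite poweR_EFin lte_fin in hN1; rewrite lee_fin in b0.
  have y0 : 0 <= bh_factor d * b by rewrite mulr_ge0// ltW// bh_factor_gt0.
  apply: le_trans (poweR_le_max di0 y0 (bh_const_le d0 Eb)) _.
  (* The alternative 1 in the maximum is covered by psi >= 1. *)
  rewrite lee_fin ge_max; apply/andP; split.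
    by rewrite (le_trans psi1)// lerDl ltW.
  have psid : 0 <= psi ^+ d by rewrite exprn_ge0// ltW.
  rewrite powRM ?(ltW (bh_factor_gt0 d))// /bh_factor powRM ?sqrtr_ge0//.
  have -> : (psi ^+ d) `^ d%:R^-1 = psi.
    rewrite -powR_mulrn ?(ltW psi0)// -powRrM mulfV ?powRr1 ?(ltW psi0)//.
    by rewrite pnatr_eq0 -lt0n.
  apply: le_trans bnd; rewrite [psi * _]mulrC.
  apply: (ler_pM _ (powR_ge0 _ _) _ (ltW hN1)).
    by rewrite mulr_ge0 ?powR_ge0 ?(ltW psi0).
  by rewrite ler_wpM2r ?(ltW psi0).
- by move: hN1; rewrite poweRyr ?gt_eqF.
Qed.

End Constants.

Theorem mainTheorem10 (R : realType) (K : nat) (hK : (2 <= K)%N) :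
  (forall (d n : nat) (hd : (1 <= d)%N) (hn : (1 <= n)%N)
          (B : 'I_(K ^ 2) -> 'M[R[i]]_K) (hB : normalized_local_basis B)
          (A : 'M[R[i]]_(tensor_dim K n)) (hA : Hledeg d A),
     ((lp_norm (bh_exp R d) (local_coef B A))%:E <=
        (Num.sqrt ((K ^ 2 - 1)%N%:R : R) * dedekind_psi R K ^+ d)%:E
          * bh_supp R d K * (op_norm A)%:E)%E)
  /\
  ((limn_esup (fun d : nat => poweR (bh_supp R d K) d%:R^-1) <= 1)%E ->
   (bh_growth R K <= (dedekind_psi R K)%:E)%E).
Proof.
by split=> [d n hd hn B hB A hA|]; [exact: local_coef_ebound|exact: bh_growth_le].
Qed.
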